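(* Let $\mathcal T$ be a rational tree such that $\mathrm{Nd}(\mathcal T)=\mathrm{Nd}^*(\mathcal T)$. Then the following hold. (a) If $\Omega(\mathcal T)=\emptyset$ then $\mathcal T$ is one of the elementary trees (E1), (E2). (b) If $|\Omega(\mathcal T)|=1$ then there is a path $(z_1,\dots,z_n)$ in $\mathcal N$ with $n>1$, $\Omega(\mathcal T)=\{z_1\}=\{v_0\}$, $\delta_{v_0}=1$ and $S(\mathcal T)=\{z_1,\dots,z_n\}$, such that the tree $\mathcal N$ is one of the following: (i) $\mathcal N=\{z_1,\dots,z_n\}$; (ii) $\mathcal N=\{z_1,\dots,z_n,y_1\}$, with $y_1\notin\{z_1,\dots,z_n\}$ adjacent in $\mathcal N$ to $z_n$ only; (iii) $\mathcal N=\{z_1,\dots,z_n,y_1,y_2\}$, with $y_1\ne y_2$ not in $\{z_1,\dots,z_n\}$, each adjacent in $\mathcal N$ to $z_n$ only. Moreover: - in case (i), $\mathrm{Nd}(\mathcal T)=\{z_n\}$ and the type of $z_n$ is either $[1]$ or $[1,1]$; - in case (ii), $V(z_n)=\{y_1\}$ and either $\mathrm{Nd}(\mathcal T)=\{y_1\}$ or $\mathrm{Nd}(\mathcal T)=\{z_n,y_1\}$; the type of $y_1$ is $[1,N_{y_1},\dots,N_{y_1}]$, and if $z_n\in\mathrm{Nd}(\mathcal T)$ then its type is $[1]$; - in case (iii), $V(z_n)=\mathrm{Nd}(\mathcal T)=\{y_1,y_2\}$ and, for each $i=1,2$, the type of $y_i$ is $[1,N_{y_i},\dots,N_{y_i}]$.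 (c) If $|\Omega(\mathcal T)|=2$ then all of the following hold: there is a $\widetilde\Delta$-trivial path $(z_1,\dots,z_n)$ such that $\mathcal N=\{z_1,\dots,z_n\}$; $n\in\{2,3\}$, and if $n=3$ then $v_0=z_2$; $a_{z_i}=1$ for all $i=1,\dots,n$; $\mathrm{Nd}(\mathcal T)=\{z_1,z_n\}$ and each node $v$ has type $[d_1,\dots,d_s]=[1,N_v,\dots,N_v]$, where $s=1\Leftrightarrow v=v_0$.
   Context: **Decorated rooted trees.** A rooted tree is a finite tree with set of cells $X_0$, edges (2-element subsets of $X_0$) and a root $v_0\in X_0$; $\delta_x$ is the valency of $x$, and $\gamma_{x,y}$ the unique path from $x$ to $y$. Arrows: $\mathcal A=\{x:\delta_x=1\}\setminus\{v_0\}$; vertices: $\mathcal V=X_0\setminus\mathcal A$. For distinct $x,y$, $x<y$ means that $x$ is on $\gamma_{v_0,y}$. In a decorated rooted tree, each arrow is decorated by $(0)$ or $(1)$ ($\mathcal A_0$ = set of arrows decorated by $(0)$), and each pair $(e,x)$ with $e$ an edge and $x\in e$ carries an integer $q(e,x)$ (decoration of $e$ near $x$). $Q(e,x)=\prod q(e',x)$ over edges $e'\ne e$ incident to $x$ (empty products are $1$). For an edge $e=\{x,y\}$ with $x,y\in\mathcal V$, $\det(e)=q(e,x)q(e,y)-Q(e,x)Q(e,y)$. A dead end is an edge incident to an element of $\mathcal A_0$. **Abstract Newton tree at infinity**: a decorated rooted tree such that (1) for each $v\in\mathcal V$ some $\alpha\in\mathcal A\setminus\mathcal A_0$ satisfies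 $\alpha>v$; (2) at most one dead end is incident to a given vertex; (3) $q(e,v_0)=1$ for all edges $e$ incident to $v_0$; (4) $q(e,\alpha)=1$ for every edge $e$ incident to an arrow $\alpha$; (5) for $v\in\mathcal V$ and distinct edges $e,e'$ incident to $v$, $q(e,v)$ and $q(e',v)$ are coprime; with $E_v^+$ the set of edges $\{v,x\}$ with $v<x$, $q(e,v)\ge1$ for all $e\in E_v^+$, at most one $e\in E_v^+$ has $q(e,v)>1$, and if a dead end $\epsilon$ is incident to $v$ then $q(\epsilon,v)=\max_{e\in E_v^+}q(e,v)$; (6) $\det(e)<0$ for every edge $e$ joining two vertices. For $v\in\mathcal V$, $\alpha\in\mathcal A\setminus\mathcal A_0$: $x_{v,\alpha}$ is the product of $q(\epsilon,u)$ over all edges $\epsilon$ not in $\gamma_{v,\alpha}$ but incident to a cell $u$ of $\gamma_{v,\alpha}$; $N_v=\sum_{\alpha\in\mathcal A\setminus\mathcal A_0}x_{v,\alpha}$. A dicritical vertex is a vertex with $N_v=0$; $\mathcal D$ is the set of dicritical vertices. The tree is **minimally complete** if (i) $N_v\ge0$ for all $v\in\mathcal V$ and each arrow decorated by $(1)$ is adjacent to a dicritical vertex; (ii) a dead end is incident to each dicritical vertex; (iii) if a dead end $e$ incident to a vertex $v$ has $q(e,v)=1$ then $v$ is dicritical; (iv) every vertex $\ne v_0$ has valency $\ne2$. **Notation.** $\mathcal N=\{v\in\mathcal V:N_v>0\}$ (a subtree containing $v_0$). $\mathcal D_v$: set of dicritical vertices adjacent to $v$. Degree $d_u$ of a dicritical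 $u$: number of $(1)$-arrows adjacent to $u$. $v\in\mathcal N$ is a node if $\mathcal D_v\neq\emptyset$; $\mathrm{Nd}(\mathcal T)$ is the set of nodes; the type of a node $v$ is the nondecreasing sequence $[d_1,\dots,d_s]$ of degrees of the elements of $\mathcal D_v$; $\mathrm{Nd}^*(\mathcal T)$ is the set of nodes whose type satisfies $\gcd(d_1,\dots,d_s)=1$. $a_v=q(e,v)$ if a dead end $e$ is incident to $v$, $a_v=1$ otherwise. $r_v=-1+$ (number of vertices adjacent to $v$). $\epsilon(v)$: number of elements of $\mathcal N$ adjacent to $v$. For $v\in\mathcal N$: $\widetilde\Delta(v)=(r_v-1)(N_v-1)+N_v(1-\frac1{a_v})-\sum_{u\in\mathcal D_v}(d_u-1)$, and $\widetilde\Delta(S)=\sum_{v\in S}\widetilde\Delta(v)$ for $S\subseteq\mathcal N$. **Rational tree**: a minimally complete abstract Newton tree at infinity with $\widetilde\Delta(\mathcal N)=0$ and $\gcd\{d_x:x\in\mathcal D\}=1$. **Teeth, skeleton.** A $\widetilde\Delta$-trivial path is a path $(z_1,\dots,z_n)$ in $\mathcal N$ with $n>1$, $\epsilon(z_1)=1$, and $\epsilon(z_i)=2$, $\widetilde\Delta(z_i)=0$ for $1<i<n$. $Z=\{z\in\mathcal N:\epsilon(z)=1,\widetilde\Delta(z)\le0\}$. $\Gamma$: set of $\widetilde\Delta$-trivial paths with $\widetilde\Delta(z_1)\le0<\widetilde\Delta(\{z_1,\dots,z_n\})$ and $z_{n-1}>z_n$. $W$: set of last vertices $z_n$ of elements of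 $\Gamma$. For $w\in W$, $V(w)=\{v:\gamma_{v,w}\in\Gamma\}$ and $\bar V(w)$ is the set of all vertices on the paths $\gamma_{v,w}$, $v\in V(w)$; for $w\in\mathcal N\setminus W$, $V(w)=\emptyset$ and $\bar V(w)=\{w\}$. $\Omega(\mathcal T)=Z\setminus\bigcup_{w\in W}V(w)$. $S(\mathcal T)=\mathcal N\setminus\bigcup_{w\in W}(\bar V(w)\setminus\{w\})$. **Elementary trees.** (E1): vertices $v_0,u$; edge $e=\{v_0,u\}$; one $(1)$-arrow and one $(0)$-arrow attached to $u$; $q(e,u)=0$ and all other edge decorations are $1$. (E2): for some positive integers $a_1,a_2$ with $\gcd(a_1,a_2)=1$: vertices $v_0,u_1,u_2$; edges $\{v_0,u_1\},\{v_0,u_2\}$; to each $u_i$ are attached one $(1)$-arrow and one $(0)$-arrow; the dead end at $u_i$ is decorated $a_i$ near $u_i$; $q(\{v_0,u_1\},u_1)=-a_2$, $q(\{v_0,u_2\},u_2)=-a_1$; all other edge decorations are $1$. *)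

(* Defs.v *)
From mathcomp Require Import all_boot all_order all_algebra.

Set Implicit Arguments.
Unset Strict Implicit.
Unset Printing Implicit Defensive.

Import Order.TTheory GRing.Theory Num.Theory.
Local Open Scope ring_scope.

(* [deco x] is the decoration of the cell [x] when [x] is an arrow ([true] for
   (1), [false] for (0)) and is meaningless otherwise.  [qd e x] is the
   decoration of the edge [e] near [x]; its values are only meaningful when
   e \in edges and x \in e. *)
Record drtree := DRTree {
  cell : finType;
  edges : {set {set cell}};
  v0 : cell;
  deco : cell -> bool;
  qd : {set cell} -> cell -> int;
  edge_card : forall e, e \in edges -> #|e| = 2%N;
  tree_connected :
    forall x y, connect [rel a b | [set a; b] \in edges] x y;
  tree_acyclic :
    forall c, (2 < size c)%N ->
      ~~ (cycle [rel a b | [set a; b] \in edges] c && uniq c)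
}.

Arguments edges : clear implicits.
Arguments v0 : clear implicits.

Section Trees.
Variable T : drtree.
Implicit Types (x y u v w a b : cell T) (e : {set cell T}) (z p : seq (cell T)).

Definition adj : rel (cell T) := [rel x y | [set x; y] \in edges T].

(* A path is given by the sequence of its cells, both end cells included;
   paths are simple. *)
Definition is_path p : bool :=
  if p is x :: p' then path adj x p' && uniq p else false.

Definition path_between x y p : bool :=
  [&& is_path p, head x p == x & last x p == y].

Lemma path_between_ex x y : exists p, path_between x y p.
Proof.
have /connectP[p pathp ->] := tree_connected x y.
have [p' pathp' uniqp' _] := shortenP pathp.
by exists (x :: p'); rewrite /path_between /= eqxx pathp' -cons_uniq uniqp' eqxx.
Qed.

Definition gam x y : seq (cell T) := xchoose (path_between_ex x y).

Lemma adjC x y : adj x y = adj y x.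
Proof. by rewrite /adj /= setUC. Qed.

Lemma simple_path_uniq p1 p2 x :
  path adj x p1 -> uniq (x :: p1) -> path adj x p2 -> uniq (x :: p2) ->
  last x p1 = last x p2 -> p1 = p2.
Proof.
elim: p1 p2 x => [|a p1 IH] [|b p2] x //.
- by move=> _ _ _ /andP[xp _] /= xE; move: xp; rewrite {1}xE mem_last.
- by move=> _ /andP[xp _] _ _ /= xE; move: xp; rewrite -{1}xE mem_last.
move=> /andP[xa pa] /andP[xp1 up1] /andP[xb pb] /andP[xp2 up2] /= lastE.
have [ab|neq_ab] := eqVneq a b.
  by rewrite -ab in pb up2 lastE *; rewrite (IH p2 a).
pose adj' := [rel u v | [&& adj u v, u != x & v != x]].
have lift s c : path adj c s -> x \notin c :: s -> path adj' c s.
  elim: s c => [//|d s IHs] c /andP[cd ps].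
  rewrite inE negb_or => /andP[xc xs].
  have xd : x != d by move: xs; rewrite inE negb_or => /andP[].
  by rewrite /= -/(adj c d) cd eq_sym xc eq_sym xd IHs.
have symc : connect_sym adj'.
  apply: sym_connect_sym => u v; rewrite /adj' /= -/(adj u v) -/(adj v u) adjC.
  by rewrite [(u != x) && _]andbC.
have ca : connect adj' a (last a p1).
  by apply/connectP; exists p1 => //; apply: lift.
have cb : connect adj' b (last b p2).
  by apply/connectP; exists p2 => //; apply: lift.
have /connectP[s ps bE] : connect adj' a b.
  by apply: connect_trans ca _; rewrite lastE symc.
case: (shortenP ps) bE => s' ps' us' _ bE.
have ax : a != x by move: xp1; rewrite inE negb_or eq_sym => /andP[].
have subadj : subrel adj' adj by move=> u v /and3P[].
have xs' : x \notin s'.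
  elim: s' (a) ps' {us' bE} => //= d s' IHs c /andP[/and3P[_ _ dx] /IHs xs'].
  by rewrite inE negb_or eq_sym dx.
have size_c : (2 < size [:: x, a & s'])%N.
  by case: s' bE {ps' us' xs'} => //= ba; rewrite ba eqxx in neq_ab.
case/negP: (tree_acyclic size_c); apply/andP; split.
  rewrite -/adj /= -/(adj x a) xa rcons_path (sub_path subadj) //=.
  by rewrite -bE -/(adj b x) adjC.
by rewrite cons_uniq us' inE negb_or eq_sym ax xs'.
Qed.

Lemma gamP x y p : reflect (p = gam x y) (path_between x y p).
Proof.
have /and3P[+ + +] := xchooseP (path_between_ex x y); rewrite -/(gam x y).
move gE: (gam x y) => g.
case: g gE => [//|x' g] gE /andP[pg ug] /eqP/= xE /eqP/= yE.
rewrite {x'}xE in gE pg ug yE *.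
apply: (iffP and3P) => [|->]; last first.
  by rewrite /= pg yE !eqxx; split=> //; move: ug => /= ->.
case: p => [[]//|x' p] [/andP[pp up] /eqP/= xE /eqP/= yE'].
rewrite {x'}xE in pp up yE' *.
by rewrite (simple_path_uniq pp up pg ug) // yE' yE.
Qed.

Definition path_edges p : seq {set cell T} :=
  if p is x :: p' then pairmap (fun a b => [set a; b]) x p' else [::].

Definition valency x : nat := #|[set e in edges T | x \in e]|.

Definition arrows : {set cell T} := [set x | valency x == 1%N] :\ v0 T.
Definition vertices : {set cell T} := ~: arrows.
Definition arrows0 : {set cell T} := [set x in arrows | ~~ deco x].
Definition arrows1 : {set cell T} := arrows :\: arrows0.

Definition below x y : bool := (x != y) && (x \in gam (v0 T) y).

Definition dead_ends : {set {set cell T}} :=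
  [set e in edges T | [exists x in e, x \in arrows0]].

Definition Qd e x : int :=
  \prod_(e' in edges T | (e' != e) && (x \in e')) qd e' x.

Definition edge_det x y : int :=
  let e := [set x; y] in qd e x * qd e y - Qd e x * Qd e y.

Definition Eplus v : {set {set cell T}} :=
  [set e in edges T | [exists x, below v x && (e == [set v; x])]].

(* In [ant5_max] the maximum is taken over integers >= 1 (by [ant5_pos]), so
   the default value 0 plays no role. *)
Record abstract_newton_tree : Prop := AbstractNewtonTree {
  ant1 : forall v, v \in vertices -> exists2 a, a \in arrows1 & below v a;
  ant2 : forall v, v \in vertices -> (#|[set e in dead_ends | v \in e]| <= 1)%N;
  ant3 : forall e, e \in edges T -> v0 T \in e -> qd e (v0 T) = 1;
  ant4 : forall e a, e \in edges T -> a \in arrows -> a \in e -> qd e a = 1;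
  ant5_coprime : forall v e e', v \in vertices ->
    e \in edges T -> e' \in edges T -> v \in e -> v \in e' -> e != e' ->
    coprimez (qd e v) (qd e' v);
  ant5_pos : forall v e, v \in vertices -> e \in Eplus v -> 1 <= qd e v;
  ant5_one : forall v, v \in vertices ->
    (#|[set e in Eplus v | (1 < qd e v)%R]| <= 1)%N;
  ant5_max : forall v e, v \in vertices -> e \in dead_ends -> v \in e ->
    qd e v = \big[Num.max/0]_(e' in Eplus v) qd e' v;
  ant6 : forall x y, x \in vertices -> y \in vertices -> adj x y ->
    edge_det x y < 0
}.

Definition xmul v a : int :=
  \prod_(u in gam v a)
    \prod_(e in edges T | (u \in e) && (e \notin path_edges (gam v a))) qd e u.

Definition Nmul v : int := \sum_(a in arrows1) xmul v a.

Definition dicriticals : {set cell T} := [set v in vertices | Nmul v == 0].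

Record minimally_complete : Prop := MinimallyComplete {
  mc1_nneg : forall v, v \in vertices -> 0 <= Nmul v;
  mc1_arrow : forall a, a \in arrows1 -> exists2 u, u \in dicriticals & adj a u;
  mc2 : forall u, u \in dicriticals -> exists2 e, e \in dead_ends & u \in e;
  mc3 : forall e v, e \in dead_ends -> v \in vertices -> v \in e ->
    qd e v = 1 -> v \in dicriticals;
  mc4 : forall v, v \in vertices -> v != v0 T -> valency v <> 2%N
}.

Definition Ncal : {set cell T} := [set v in vertices | 0 < Nmul v].

Definition dicr_at v : {set cell T} := [set u in dicriticals | adj v u].

Definition degree u : nat := #|[set a in arrows1 | adj u a]|.

Definition nodes : {set cell T} := [set v in Ncal | dicr_at v != set0].

Definition node_type v : seq nat := sort leq [seq degree u | u in dicr_at v].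

Definition nodes_star : {set cell T} :=
  [set v in nodes | \big[gcdn/0%N]_(d <- node_type v) d == 1%N].

Definition amul v : int :=
  if [pick e in dead_ends | v \in e] is Some e then qd e v else 1.

Definition rval v : int := (#|[set x in vertices | adj v x]|)%:Z - 1.

Definition eps v : nat := #|[set x in Ncal | adj v x]|.

Definition Delta v : rat :=
  (rval v - 1)%:~R * (Nmul v - 1)%:~R
  + (Nmul v)%:~R * (1 - 1 / (amul v)%:~R)
  - \sum_(u in dicr_at v) ((degree u)%:R - 1).

Definition DeltaS (S : {set cell T}) : rat := \sum_(v in S) Delta v.

Record rational_tree : Prop := RationalTree {
  rt_newton : abstract_newton_tree;
  rt_complete : minimally_complete;
  rt_Delta : DeltaS Ncal = 0;
  rt_gcd : \big[gcdn/0%N]_(u in dicriticals) degree u = 1%N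
}.

(* The cell z_i of a path (z_1, ..., z_n) is [nth (v0 T) z i.-1]. *)
Definition trivial_path z : bool :=
  [&& is_path z, all [in Ncal] z, (1 < size z)%N, eps (head (v0 T) z) == 1%N
    & [forall i : 'I_(size z), (0 < i < (size z).-1)%N ==>
         (eps (nth (v0 T) z i) == 2%N) && (Delta (nth (v0 T) z i) == 0)]].

Definition Zset : {set cell T} := [set x in Ncal | (eps x == 1%N) && (Delta x <= 0)].

Definition Gamma z : bool :=
  [&& trivial_path z, Delta (head (v0 T) z) <= 0, 0 < DeltaS [set x in z]
    & below (last (v0 T) z) (nth (v0 T) z (size z).-2)].

Definition Wset : {set cell T} := [set w | [exists v, Gamma (gam v w)]].

Lemma WsetP w :
  reflect (exists2 z, Gamma z & w = last (v0 T) z) (w \in Wset).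
Proof.
rewrite inE; apply: (iffP existsP) => [[v Gv]|[z Gz ->]].
  exists (gam v w) => //; have /gamP := erefl (gam v w).
  by case: (gam v w) => [|c p]; rewrite /path_between //= => /and3P[_ _ /eqP].
case: z Gz => [|v z Gz]; first by case/and3P.
exists v; rewrite /= -(_ : v :: z = gam v (last v z)) //.
by apply/gamP; case/and4P: Gz => /andP[pz _] _ _ _; rewrite /path_between pz /= !eqxx.
Qed.

Definition Vset w : {set cell T} := [set v | Gamma (gam v w)].

Definition Vbar w : {set cell T} :=
  if w \in Wset then \bigcup_(v in Vset w) [set x in gam v w] else [set w].

Definition Omega : {set cell T} := Zset :\: \bigcup_(w in Wset) Vset w.

Definition skeleton : {set cell T} :=
  Ncal :\: \bigcup_(w in Wset) (Vbar w :\ w).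

Definition elementary1 : Prop :=
  exists u a b,
    [/\ uniq [:: v0 T; u; a; b] /\ (forall x, x \in [:: v0 T; u; a; b]),
        edges T = [set [set v0 T; u]; [set u; a]; [set u; b]],
        deco a /\ ~~ deco b,
        qd [set v0 T; u] u = 0
      & forall e x, e \in edges T -> x \in e -> (e, x) != ([set v0 T; u], u) ->
          qd e x = 1].

Definition elementary2 : Prop :=
  exists (a1 a2 : nat) u1 u2 al1 al2 be1 be2,
    [/\ [/\ (0 < a1)%N, (0 < a2)%N & gcdn a1 a2 = 1%N],
        uniq [:: v0 T; u1; u2; al1; al2; be1; be2]
          /\ (forall x, x \in [:: v0 T; u1; u2; al1; al2; be1; be2]),
        edges T = [set e in [:: [set v0 T; u1]; [set v0 T; u2];
                                [set u1; al1]; [set u1; be1];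
                                [set u2; al2]; [set u2; be2]]],
        [/\ deco al1, deco al2, ~~ deco be1 & ~~ deco be2]
      & [/\ qd [set u1; be1] u1 = a1%:Z, qd [set u2; be2] u2 = a2%:Z,
            qd [set v0 T; u1] u1 = - a2%:Z, qd [set v0 T; u2] u2 = - a1%:Z
          & forall e x, e \in edges T -> x \in e ->
              (e, x) \notin [:: ([set u1; be1], u1); ([set u2; be2], u2);
                                ([set v0 T; u1], u1); ([set v0 T; u2], u2)] ->
              qd e x = 1]].

(* [type_1N v]: the type of v is [1, N_v, ..., N_v], the number of entries N_v
   being possibly 0. *)
Definition type_1N v : Prop :=
  exists k, [seq d%:Z | d <- node_type v] = 1 :: nseq k (Nmul v).

Definition Nneighbors v : {set cell T} := [set x in Ncal | adj v x].

End Trees.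

Arguments arrows : clear implicits.
Arguments vertices : clear implicits.
Arguments arrows0 : clear implicits.
Arguments arrows1 : clear implicits.
Arguments dead_ends : clear implicits.
Arguments dicriticals : clear implicits.
Arguments Ncal : clear implicits.
Arguments nodes : clear implicits.
Arguments nodes_star : clear implicits.
Arguments Zset : clear implicits.
Arguments Wset : clear implicits.
Arguments Omega : clear implicits.
Arguments skeleton : clear implicits.

(* Main.v *)
Require Import Defs.
From mathcomp Require Import all_boot all_order all_algebra.
From mathcomp Require Import zify ring.

(** The proof rests on a linear description of the multiplicities N_v and on a
    sign analysis of Delta over the tree N.

    Cutting an edge {x, y} splits the (1)-arrows into those behind y and those
    behind x.  Up to decorations near x, the part of N_x coming from the arrows
    behind y is a number [branch x y] that N_x and N_y share, and these numbers
    satisfy a recursion along the tree ([Nmul_branch], [branch_step]).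
    Eliminating the other side of the edge gives, for a child y of x,
      N_x Q(e, y) - N_y q(e, x) = - det(e) * branch x y > 0   ([edge_identity]),
    whence: every vertex with a child vertex lies in N, so dicritical vertices
    are leaves; N_v = - det(e) d_u for u in D_v, so the degrees d_u divide N_v
    ([dicr_det]); and N_v >= 2 as soon as v has a child in N ([Nmul_ge2]).

    Since r_v - 1 = eps(v) + |D_v| - 2,
      Delta(v) = (eps(v) - 2)(N_v - 1) + N_v (1 - 1/a_v)
                 + sum over u in D_v of (N_v - d_u),
    an integer because a_v divides N_v ([DeltaE]).  Only the first term can be
    negative, and only for eps(v) <= 1.  As the type of a node has gcd 1 and its
    entries divide N_v, either the type is [1, N_v, ..., N_v] or two entries are
    at most N_v / 2; in both cases the last sum is at least N_v - 1
    ([defect_node]).  Consequently, away from the root, Delta(v) > 0 if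
    eps(v) >= 2 ([inner_DeltaZ]), while a leaf v of N has Delta(v) >= 0, with
    equality only if a_v = 1 and the type is [1, N_v, ..., N_v] ([leaf_DeltaZ]).
    It follows that Gamma consists of the two-term paths from a leaf with
    Delta = 0 to its parent ([Gamma_gam]), so that S(T) and Omega(T) are obtained
    from N and Z by removing such leaves.

    The total of Delta being 0, the sign at the root separates three cases.
    If N = {v_0}, then N_{v_0} = sum of a_u d_u over D_{v_0} and
    sum of (N_{v_0} - d_u) = 2 (N_{v_0} - 1) leave room for one or two dicritical
    vertices only, which gives (E1) and (E2) ([elementary_case]).  If N has
    further vertices and v_0 has valency different from 1, then Delta vanishes
    everywhere, every vertex of N other than v_0 is a leaf adjacent to v_0, and
    v_0 has at most two neighbours in N: this is (c) ([two_leaves_case]).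

    If v_0 has valency 1, then Delta(v_0) = 1 - N_{v_0} has to be compensated by
    the other vertices.  One follows the chain v_0 = z_1, z_2, ... as long as
    eps = 2 and there is no dicritical neighbour ([chain]).  Such a z_i carries a
    dead end, no arrow lies behind it, and the contributions telescope: after the
    chain up to z, with next vertex c and M = branch z c, at most M - 1 remains
    for c and everything beyond, while N_c is a multiple of M.  Comparing with
    the lower bounds for Delta(c) leaves only the possibilities of (b)
    ([leaf_end], [inner_end]). *)

Set Implicit Arguments.
Unset Strict Implicit.
Unset Printing Implicit Defensive.

Import Order.TTheory GRing.Theory Num.Theory.
Local Open Scope ring_scope.

(** * Paths, branches and the multiplicities N_v *)

Section Walk.
Variable T : drtree.
Implicit Types (x y z u v w a b c : cell T) (e : {set cell T}).

Lemma adj_neq x y : adj x y -> x != y.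
Proof.
rewrite /adj /= => /edge_card; rewrite cards2; by case: eqP.
Qed.

Lemma adj_irr x : adj x x = false.
Proof. by apply/negP => /adj_neq; rewrite eqxx. Qed.

Lemma gamxx x : gam x x = [:: x].
Proof. by apply/esym/gamP; rewrite /path_between /= !eqxx. Qed.

Lemma gam_path x y : path_between x y (gam x y).
Proof. by apply/gamP. Qed.

Lemma gam_uniq x y : uniq (gam x y).
Proof.
have /and3P[+ _ _] := gam_path x y.
by case: (gam x y) => [//|c p] /andP[].
Qed.

(** The default value [x] makes [toward x x = x], so that [toward_flip] holds for
    every [a]. *)
Definition toward x a := nth x (gam x a) 1.

Lemma towardxx x : toward x x = x.
Proof. by rewrite /toward gamxx. Qed.

Lemma gamE x a : x != a ->
  [/\ adj x (toward x a), gam x a = x :: gam (toward x a) a & x \notin gam (toward x a) a].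
Proof.
move=> xa; have /and3P[] := gam_path x a; rewrite /toward.
case gE: (gam x a) => [//|x' p] /andP[px ux] /eqP/= xE /eqP/= aE.
rewrite {x'}xE in gE px ux aE *.
case: p => [|y p] /= in gE px ux aE *; first by rewrite aE eqxx in xa.
case/andP: px => xy py; case/andP: ux => xp up.
have <- : y :: p = gam y a.
  by apply/gamP; rewrite /path_between /is_path /= py eqxx aE eqxx; move: up => /= ->.
by split.
Qed.

Lemma mem_gam_l x a : x \in gam x a.
Proof.
have [->|/gamE[_ -> _]] := eqVneq x a; first by rewrite gamxx mem_seq1.
by rewrite mem_head.
Qed.

Lemma gam_cons x y a : adj x y -> x \notin gam y a -> gam x a = x :: gam y a.
Proof.
move=> xy xp; apply/esym/gamP.
have /and3P[] := gam_path y a.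
case gE: (gam y a) xp => [//|y' p] xp /andP[py uy] /eqP/= yE /eqP/= aE.
rewrite {y'}yE in gE py uy xp aE *.
by rewrite /path_between /is_path /= xy py aE !eqxx; rewrite /= in xp uy; rewrite xp uy.
Qed.

Lemma toward_adj x y : adj x y -> toward x y = y.
Proof.
move=> xy; rewrite /toward (gam_cons xy) ?gamxx //.
by rewrite mem_seq1; exact: adj_neq.
Qed.

(** By uniqueness of paths, the piece of [gam x a] between [x] and its neighbour
    [y] is the edge joining them. *)
Lemma gam_adj_mem x y a : adj x y -> y \in gam x a -> gam x a = x :: gam y a.
Proof.
move=> xy ya.
have xa : x != a.
  apply: contraTneq ya => <-; rewrite gamxx mem_seq1 eq_sym; exact: adj_neq.
have [_ gE _] := gamE xa.
have /and3P[] := gam_path x a; rewrite {}gE in ya *.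
move: (gam (toward x a) a) ya => p yp /andP[pp up] _ /eqP/= aE.
have yx : y \in p.
  by move: yp; rewrite inE eq_sym (negbTE (adj_neq xy)).
case/splitPr: yx pp up aE {yp} => p1 p2; rewrite cat_path last_cat /= => pp up aE.
case/and3P: pp => pp1 lp1 pp2.
have p1E : rcons p1 y = [:: y].
  apply: (@simple_path_uniq T _ _ x).
  - by rewrite rcons_path pp1.
  - move: up; rewrite mem_cat cat_uniq inE negb_or /= => /andP[/andP[xp1 /norP[xy' _]]].
    case/and3P=> up1 /norP[yp1 _] _.
    by rewrite mem_rcons inE negb_or xy' xp1 rcons_uniq yp1 up1.
  - by rewrite /= andbT; exact: xy.
  - by rewrite /= andbT mem_seq1; exact: adj_neq.
  - by rewrite last_rcons.
have {}p1E : p1 = [::] by case: (p1) p1E => [//|? []].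
rewrite p1E /= in up *; congr (x :: _); apply/gamP.
rewrite /path_between /is_path /= pp2 aE !eqxx.
by case/and3P: up => _ -> ->.
Qed.

(** Removing the edge between [x] and [y] separates the tree into two parts, and
    exactly one of [x] and [y] has to cross this edge to reach [a]. *)
Lemma toward_flip x y a : adj x y -> (toward x a == y) = (toward y a != x).
Proof.
move=> xy; have yx : adj y x by rewrite adjC.
have [xin|xnin] := boolP (x \in gam y a).
  have gyE := gam_adj_mem yx xin.
  have ynx : y \notin gam x a by have := gam_uniq y a; rewrite gyE => /andP[].
  have -> : toward y a = x.
    rewrite /toward gyE /=.
    have [xa|/gamE[_ -> _] //] := eqVneq x a; by rewrite xa gamxx.
  rewrite eqxx; apply/negbTE; apply: contra ynx => /eqP nE.
  have [xa|/gamE[_ -> _]] := eqVneq x a.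
    by move: nE; rewrite xa towardxx => ->; rewrite gamxx mem_head.
  by rewrite nE inE mem_gam_l orbT.
have gxE := gam_cons xy xnin.
have -> : toward x a = y.
  rewrite /toward gxE /=.
  have [ya|/gamE[_ -> _] //] := eqVneq y a; by rewrite ya gamxx.
rewrite eqxx; apply/esym; apply: contra xnin => /eqP nE.
have [ya|/gamE[_ -> _]] := eqVneq y a.
  by move: nE; rewrite ya towardxx => ->; rewrite gamxx mem_head.
by rewrite nE inE mem_gam_l orbT.
Qed.

Lemma toward_gam x y a : adj x y -> toward x a = y ->
  gam x a = x :: gam y a /\ x \notin gam y a.
Proof.
move=> xy nE.
have xa : x != a by apply: contraTneq xy => xa; rewrite -nE -xa towardxx adj_irr.
by have [_] := gamE xa; rewrite nE.
Qed.

Lemma edgeP e x : e \in edges T -> x \in e -> exists2 y, adj x y & e = [set x; y].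
Proof.
move=> eT xe; have := edge_card eT.
rewrite (cardsD1 x) xe => -[/eqP/cards1P[y yE]].
have eE : e = [set x; y] by rewrite -(setD1K xe) yE.
by exists y => //; rewrite /adj /= -eE.
Qed.

Lemma set2_inj x : injective (fun y => [set x; y]).
Proof.
move=> y z /= /setP E.
have := E y; have := E z; rewrite !inE !eqxx !orbT.
case: (eqVneq z x) => [->|zx] /=; last by move=> /eqP.
by case: (eqVneq y x) => [->|] //= _ _ /esym/eqP.
Qed.

Lemma edges_at x :
  [set e in edges T | x \in e] = [set [set x; y] | y in [set y | adj x y]].
Proof.
apply/setP => e; rewrite inE; apply/andP/imsetP => [[eT xe]|[y]].
  by have [y xy eE] := edgeP eT xe; exists y; rewrite ?inE.
by rewrite inE => xy ->; rewrite !inE eqxx.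
Qed.

Lemma valencyE x : valency x = #|[set y | adj x y]|.
Proof. by rewrite /valency edges_at card_imset //; exact: set2_inj. Qed.

(** [near x y] and [Q x y] are the numbers q(e, x) and Q(e, x) for e = {x, y};
    [Q2 x y z] leaves out two edges, those of a path passing through [x]. *)
Definition near x y := qd [set x; y] x.
Definition Q x y : int := \prod_(t | adj x t && (t != y)) near x t.
Definition Q2 x y z : int := \prod_(t | [&& adj x t, t != y & t != z]) near x t.

Lemma big_edges x (P : pred {set cell T}) :
  \prod_(e in edges T | (x \in e) && P e) qd e x =
  \prod_(y | adj x y && P [set x; y]) near x y.
Proof.
rewrite (eq_bigl (fun e => (e \in [set [set x; y] | y in [set y | adj x y]])
   && P e)); last by move=> e; rewrite andbA -edges_at inE.
rewrite big_imset_cond /=; last by move=> y z _ _; exact: set2_inj.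
by apply: eq_bigl => y; rewrite inE.
Qed.

Lemma QdE x y : Qd [set x; y] x = Q x y.
Proof.
rewrite /Qd /Q (eq_bigl (fun e => (e \in edges T) && ((x \in e) && (e != [set x; y])))).
  rewrite big_edges; apply: eq_bigl => t; congr (_ && _); congr negb.
  by apply/eqP/eqP => [/set2_inj|->].
by move=> e; rewrite [_ && (e != _)]andbC.
Qed.

Lemma edge_detE x y : edge_det x y = near x y * near y x - Q x y * Q y x.
Proof. by rewrite /edge_det /near QdE [in Qd _ y]setUC QdE [in qd _ y]setUC. Qed.

Lemma Q_Q2 x y z : adj x z -> z != y -> Q x y = near x z * Q2 x y z.
Proof.
move=> xz zy; rewrite /Q (bigD1 z) ?xz //=; congr (_ * _).
by apply: eq_bigl => t; rewrite andbA.
Qed.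

Lemma Q2C x y z : Q2 x y z = Q2 x z y.
Proof. by apply: eq_bigl => t; rewrite [(t != y) && _]andbC. Qed.

Lemma path_edges_mem p e u : e \in path_edges p -> u \in e -> u \in p.
Proof.
case: p => [//|x p] /=; elim: p x => [//|y p IH] x /=.
rewrite inE => /orP[/eqP->|/IH uIH /uIH uyp].
  by rewrite !inE => /orP[]->; rewrite ?orbT.
by rewrite inE uyp orbT.
Qed.

(** The factor of x_{v,a} contributed by a cell [u] of the path [p]. *)
Definition off p u : int :=
  \prod_(y | adj u y && ([set u; y] \notin path_edges p)) near u y.

Lemma xmulE v a : xmul v a = \prod_(u <- gam v a) off (gam v a) u.
Proof.
rewrite /xmul big_uniq ?gam_uniq //=; apply: eq_bigr => u _.
by rewrite big_edges.
Qed.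

(** What is left of x_{x,a} when the decorations near [x] are dropped.  It does
    not depend on what lies behind [x], and so enters N_x and N_y alike. *)
Definition bweight x y a : int := \prod_(u <- gam y a) off (x :: gam y a) u.

Lemma path_edges_cons x y a :
  path_edges (x :: gam y a) = [set x; y] :: path_edges (gam y a).
Proof.
have /and3P[] := gam_path y a; case: (gam y a) => [//|y' p] _ /eqP/= -> _.
by [].
Qed.

Lemma gam_notin_edges x y a t : x \notin gam y a ->
  [set x; t] \notin path_edges (gam y a).
Proof. by apply: contra => /path_edges_mem; apply; rewrite !inE eqxx. Qed.

Lemma eq_set2 x y z : ([set x; y] == [set x; z]) = (y == z).
Proof. by apply/eqP/eqP => [/set2_inj|->]. Qed.

Lemma xmul_bweight x y a : adj x y -> toward x a = y ->
  xmul x a = Q x y * bweight x y a.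
Proof.
move=> xy /(toward_gam xy)[gE xg]; rewrite xmulE gE big_cons; congr (_ * _).
apply: eq_bigl => t; rewrite path_edges_cons inE negb_or gam_notin_edges // andbT.
by rewrite eq_set2.
Qed.

Lemma off_cons x y a u : u != x -> u != y ->
  off (x :: gam y a) u = off (gam y a) u.
Proof.
move=> ux uy; apply: eq_bigl => t; rewrite path_edges_cons inE negb_or.
suff -> : [set u; t] != [set x; y] by [].
apply: contraNneq uy => /setP/(_ u); rewrite !inE eqxx (negbTE ux) /=.
by move=> <-.
Qed.

Lemma bweight_step x y z a : adj x y -> toward x a = y -> adj y z -> toward y a = z ->
  bweight x y a = Q2 y x z * bweight y z a.
Proof.
move=> xy /(toward_gam xy)[_ xg] yz /(toward_gam yz)[gE yg].
rewrite /bweight gE big_cons; congr (_ * _).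
  apply: eq_bigl => t; rewrite -gE path_edges_cons gE path_edges_cons !inE !negb_or.
  rewrite gam_notin_edges // andbT eq_set2 [[set x; y]]setUC eq_set2.
  by [].
apply: eq_big_seq => u ug; rewrite -gE off_cons //.
  by apply: contraNneq xg => <-; rewrite gE inE ug orbT.
by apply: contraNneq yg => <-.
Qed.

Definition branch x y : int := \sum_(a in arrows1 T | toward x a == y) bweight x y a.

(** Group the arrows according to the first step of the path from [x]. *)
Lemma Nmul_branch x : x \notin arrows1 T ->
  Nmul x = \sum_(y | adj x y) Q x y * branch x y.
Proof.
move=> xA; rewrite /Nmul (partition_big (toward x) (adj x)) /=; last first.
  move=> a aA; suff xa : x != a by have [] := gamE xa.
  by apply: contraNneq xA => ->.
apply: eq_bigr => y xy; rewrite mulr_sumr; apply: eq_bigr => a /andP[_ /eqP].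
exact: xmul_bweight.
Qed.

(** The same grouping at [y]; the step back to [x] is excluded. *)
Lemma branch_step x y : adj x y -> y \notin arrows1 T ->
  branch x y = \sum_(z | adj y z && (z != x)) Q2 y x z * branch y z.
Proof.
move=> xy yA.
rewrite /branch (partition_big (toward y) (fun z => adj y z && (z != x))) /=; last first.
  move=> a /andP[aA]; rewrite (toward_flip _ xy) => ->; rewrite andbT.
  suff ya : y != a by have [] := gamE ya.
  by apply: contraNneq yA => ->.
apply: eq_bigr => z /andP[yz zx]; rewrite mulr_sumr.
apply: eq_big => [a|a /andP[/andP[aA /eqP xa] /eqP ya]].
  rewrite (toward_flip _ xy) -andbA; congr (_ && _).
  by case: (eqVneq (toward y a) z) => [->|]; rewrite ?zx ?andbF.
exact: bweight_step.
Qed.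

Lemma arrow_adj x y a : a \in arrows T -> adj a x -> adj a y -> x = y.
Proof.
rewrite !inE valencyE => /andP[_ /cards1P[t tE]] ax ay.
by move/setP: tE => tE; have := tE x; have := tE y; rewrite !inE ax ay => /esym/eqP-> /esym/eqP.
Qed.

Lemma toward_arrow x a b : a \in arrows T -> adj x a -> (toward x b == a) = (b == a).
Proof.
move=> aA xa; have ax : adj a x by rewrite adjC.
case: (eqVneq b a) => [->|ba]; first by rewrite toward_adj ?eqxx.
rewrite (toward_flip _ xa); have [ab _ _] := gamE (etrans (congr1 negb (eq_sym a b)) ba).
by rewrite (arrow_adj aA ab ax) eqxx.
Qed.

Lemma branch_arrow1 x a : a \in arrows1 T -> adj x a -> branch x a = 1.
Proof.
move=> aA xa; have aA' : a \in arrows T by case/setDP: aA.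
rewrite /branch (eq_bigl (fun b => b == a)) => [|b]; last first.
  by rewrite toward_arrow //; case: eqP => [->|]; rewrite ?aA ?andbF.
rewrite big_pred1_eq /bweight gamxx big_seq1 /off big_pred0 // => t.
apply/negbTE/negP => /andP[att]; rewrite inE.
have -> : t = x by apply: (arrow_adj aA') => //; rewrite adjC.
by rewrite setUC eqxx.
Qed.

Lemma branch_arrow0 x b : b \in arrows0 T -> adj x b -> branch x b = 0.
Proof.
move=> bA xb; have bA' : b \in arrows T by move: bA; rewrite inE => /andP[].
rewrite /branch big_pred0 // => a; rewrite toward_arrow //.
by apply/negP => /andP[/setDP[_ /negP H] /eqP E]; apply: H; rewrite E.
Qed.

End Walk.

(** * Parents, children and decorations *)

Section Rooted.
Variable T : drtree.
Implicit Types (x y z u v w a b c : cell T) (e : {set cell T}).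

Definition child x y := adj x y && (toward y (v0 T) == x).

Lemma child_adj x y : child x y -> adj x y.
Proof. by case/andP. Qed.

Lemma child_adjC x y : child x y -> adj y x.
Proof. by move=> /child_adj; rewrite adjC. Qed.

(** An instance of [toward_flip] for the root. *)
Lemma childE x y : adj x y -> child x y = ~~ child y x.
Proof.
move=> xy; rewrite /child xy adjC xy /= (toward_flip _ xy); by rewrite negbK.
Qed.

Lemma child_inj x x' y : child x y -> child x' y -> x = x'.
Proof. by move=> /andP[_ /eqP <-] /andP[_ /eqP <-]. Qed.

Lemma child_root x : child x (v0 T) = false.
Proof.
by apply/negP => /andP[xv /eqP]; rewrite towardxx => vE; rewrite vE adj_irr in xv.
Qed.

Lemma child_neq x y : child x y -> x != y.
Proof. by move/child_adj/adj_neq. Qed.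

Lemma child_of_adj p x t : child p x -> adj x t -> t != p -> child x t.
Proof.
move=> px xt tp; rewrite childE //; apply: contraNN tp => tx.
by rewrite (child_inj px tx).
Qed.

Lemma child_v0 t : adj (v0 T) t -> child (v0 T) t.
Proof. by move=> h; rewrite childE // child_root. Qed.

Definition parent y := toward y (v0 T).

Lemma child_parent y : y != v0 T -> child (parent y) y.
Proof. by move=> /gamE[yp _ _]; rewrite /child adjC yp eqxx. Qed.

Lemma child_gam x y : child x y -> gam y (v0 T) = y :: gam x (v0 T).
Proof. by move=> /andP[xy /eqP yx]; have [] := toward_gam (etrans (adjC y x) xy) yx. Qed.

Lemma rooted_ind (P : cell T -> Prop) :
  P (v0 T) -> (forall x y, child x y -> P x -> P y) -> forall y, P y.
Proof.
move=> P0 PS y; have [n] := ubnP (size (gam y (v0 T))).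
elim: n y => [//|n IH] y; have [->//|y0] := eqVneq y (v0 T).
have py := child_parent y0; rewrite (child_gam py) /= ltnS => /IH; exact: PS.
Qed.

Lemma gam_rev x y : gam y x = rev (gam x y).
Proof.
have := gam_path x y.
case gE: (gam x y) => [//|x' p] /and3P[/andP[pp up] /eqP/= xE /eqP/= yE].
rewrite {x'}xE in gE pp up yE *; apply/esym/gamP.
have rE : rev (x :: p) = y :: rev (belast x p) by rewrite lastI rev_rcons yE.
have ur : uniq (rev (x :: p)) by rewrite rev_uniq.
rewrite rE in ur *; rewrite /path_between /is_path /= eqxx -{1}yE rev_path.
rewrite (eq_path (e' := adj (T := T))) ?pp; last by move=> u v; rewrite adjC.
move: ur => /= -> /=; case: (p) yE => [<- /=|c s _] /=; first by rewrite eqxx.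
by rewrite rev_cons last_rcons eqxx.
Qed.

Lemma below_child x y : adj x y -> below x y = child x y.
Proof.
move=> xy; rewrite /below (adj_neq xy) /= gam_rev mem_rev.
apply/idP/idP => [xin|xy']; last by rewrite (child_gam xy') inE mem_gam_l orbT.
rewrite /child xy /=.
by apply: contraLR xin; rewrite -(toward_flip _ xy) => /eqP /(toward_gam xy)[].
Qed.

Lemma Eplus_child v x : child v x -> [set v; x] \in Eplus v.
Proof.
move=> vx; rewrite inE; have := child_adj vx; rewrite {1}/adj /= => ->.
by apply/existsP; exists x; rewrite below_child ?(child_adj vx) // vx eqxx.
Qed.

Lemma gam_child c v : c \in gam v (v0 T) -> v != c ->
  exists2 c', child c c' & c' \in gam v (v0 T).
Proof.
elim/rooted_ind: v => [|x y xy IH]; first by rewrite gamxx inE => /eqP->; rewrite eqxx.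
rewrite (child_gam xy) inE eq_sym => /orP[/eqP->|cx _]; first by rewrite eqxx.
have [xc|/IH[//|c' cc' c'x]] := eqVneq x c; last by exists c'; rewrite // inE c'x orbT.
by exists y; rewrite ?mem_head // -xc.
Qed.

Lemma v0_gam v : v0 T \in gam v (v0 T).
Proof.
by elim/rooted_ind: v => [|x y /child_gam->]; rewrite ?gamxx ?mem_head // inE => ->; rewrite orbT.
Qed.

Lemma v0V : v0 T \in vertices T.
Proof. by rewrite !inE eqxx. Qed.

Lemma arrow_child x a : a \in arrows T -> adj x a -> child x a.
Proof.
move=> aA xa; have a0 : a != v0 T by move: aA; rewrite !inE => /andP[].
have pa := child_parent a0.
by rewrite (arrow_adj aA (_ : adj a x) (_ : adj a (parent a))) // ?(child_adjC pa) // adjC.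
Qed.

Lemma arrow_leaf a x : a \in arrows T -> child a x = false.
Proof.
move=> aA; apply/negP => ax; have xa := child_adjC ax.
by have := arrow_child aA xa; rewrite childE ?ax.
Qed.

Lemma arrows0A a : a \in arrows0 T -> a \in arrows T.
Proof. by rewrite inE => /andP[]. Qed.

Lemma arrows1A a : a \in arrows1 T -> a \in arrows T.
Proof. by case/setDP. Qed.

Lemma arrows01 a : a \in arrows1 T -> a \in arrows0 T -> False.
Proof. by case/setDP=> _ /negP. Qed.

Lemma arrowsP a : a \in arrows T -> (a \in arrows0 T) \/ (a \in arrows1 T).
Proof. by move=> aA; have [|n0] := boolP (a \in arrows0 T); [left|right; apply/setDP]. Qed.

Lemma VA v : (v \in vertices T) = (v \notin arrows T).
Proof. by rewrite inE. Qed.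

Lemma V_arrows1 v : v \in vertices T -> v \notin arrows1 T.
Proof. by rewrite VA; apply: contra => /arrows1A. Qed.

Lemma V_arrows0 v : v \in vertices T -> v \notin arrows0 T.
Proof. by rewrite VA; apply: contra => /arrows0A. Qed.

Lemma dead_endsE v b : v \in vertices T -> adj v b ->
  ([set v; b] \in dead_ends T) = (b \in arrows0 T).
Proof.
move=> vV; rewrite inE /adj /= => ->; apply/exists_inP/idP => [[x]|bA]; last by exists b; rewrite ?set22.
by move=> /set2P[]-> // vA; have := V_arrows0 vV; rewrite vA.
Qed.

Lemma dead_endP v e : v \in vertices T -> e \in dead_ends T -> v \in e ->
  exists b, [/\ b \in arrows0 T, adj v b & e = [set v; b]].
Proof.
move=> vV eD ve; have eT : e \in edges T by move: eD; rewrite inE => /andP[].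
have [b vb eE] := edgeP eT ve; exists b; split=> //.
by rewrite -(dead_endsE vV vb) -eE.
Qed.

(** The branches at [x] other than the one through [y] all carry the decoration
    [near x y], and add up to the branch at [y] through [x]. *)
Lemma Nmul_edge x y : adj x y -> x \notin arrows1 T ->
  Nmul x = Q x y * branch x y + near x y * branch y x.
Proof.
move=> xy xA; have yx : adj y x by rewrite adjC.
rewrite Nmul_branch // (bigD1 y) //= (branch_step yx xA) mulr_sumr; congr (_ + _).
apply: eq_bigr => z /andP[xz zy]; rewrite (Q_Q2 xy) 1?eq_sym // Q2C; ring.
Qed.

(** Both N_x and N_y are combinations of [branch x y] and [branch y x]; this is
    the combination in which [branch y x] cancels. *)
Lemma edge_identity x y : adj x y -> x \notin arrows1 T -> y \notin arrows1 T ->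
  Nmul x * Q y x - Nmul y * near x y = branch x y * (- edge_det x y).
Proof.
move=> xy xA yA; have yx : adj y x by rewrite adjC.
rewrite (Nmul_edge xy) // (Nmul_edge yx) // edge_detE; ring.
Qed.

Section Newton.
Hypothesis HT : abstract_newton_tree T.

Lemma near_ge1 v x : v \in vertices T -> child v x -> 1 <= near v x.
Proof. by move=> vV /Eplus_child; exact: ant5_pos. Qed.

Lemma near_root x : adj (v0 T) x -> near (v0 T) x = 1.
Proof. by move=> vx; apply: (ant3 HT); rewrite ?set21. Qed.

Lemma near_coprime v x y : v \in vertices T -> adj v x -> adj v y -> x != y ->
  coprimez (near v x) (near v y).
Proof.
move=> vV vx vy xy; apply: (ant5_coprime HT); rewrite ?set21 ?eq_set2 //.
Qed.

(** At most one edge leading away from the root has a decoration above 1. *)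
Lemma near_one v x y : v \in vertices T -> child v x -> child v y -> x != y ->
  near v x = 1 \/ near v y = 1.
Proof.
move=> vV vx vy xy; have := near_ge1 vV vx; have := near_ge1 vV vy.
rewrite !le_eqVlt eq_sym => /orP[/eqP|y1]; first by right.
rewrite eq_sym => /orP[/eqP|x1]; first by left.
have := ant5_one HT vV; rewrite leqNgt => /negP[].
rewrite (cardsD1 [set v; x]) inE Eplus_child //= x1 ltnS card_gt0.
apply/set0Pn; exists [set v; y]; apply/setD1P; split; first by rewrite eq_set2 eq_sym.
by rewrite inE Eplus_child.
Qed.

(** The decoration of the dead end is the largest one, and at most one of them
    exceeds 1. *)
Lemma near_dead v b x : v \in vertices T -> b \in arrows0 T -> adj v b ->
  child v x -> x != b -> near v x = 1.
Proof.
move=> vV bA vb vx xb.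
have vb' : child v b by apply: arrow_child => //; exact: arrows0A.
have [//|b1] := near_one vV vx vb' xb.
have eD : [set v; b] \in dead_ends T by rewrite dead_endsE.
have := ant5_max HT vV eD (set21 _ _); rewrite -/(near v b) b1 => E.
apply/eqP; rewrite eq_le near_ge1 // andbT E.
exact: (@le_bigmax_cond _ _ _ 0 [set v; x] (mem (Eplus v)) (fun e => qd e v) (Eplus_child vx)).
Qed.

Lemma dead_unique v b b' : v \in vertices T -> b \in arrows0 T -> b' \in arrows0 T ->
  adj v b -> adj v b' -> b = b'.
Proof.
move=> vV bA bA' vb vb'; apply/eqP; have := ant2 HT vV.
apply: contraLR => bb'; rewrite -ltnNge (cardsD1 [set v; b]) inE dead_endsE // bA set21 /=.
rewrite add1n ltnS card_gt0; apply/set0Pn; exists [set v; b'].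
apply/setD1P; split; first by rewrite eq_set2 eq_sym.
by rewrite inE dead_endsE // bA' set21.
Qed.

End Newton.
End Rooted.

(** * Branch sums away from the root, and dicritical vertices *)

Lemma prod_ge1 (I : finType) (P : pred I) (F : I -> int) :
  (forall i, P i -> 1 <= F i) -> 1 <= \prod_(i | P i) F i.
Proof.
move=> F1; elim/big_ind: _ => // x y x1 y1; nia.
Qed.

Section Complete.
Variable T : drtree.
Implicit Types (x y z u v w a b c p : cell T) (e : {set cell T}).
Hypothesis HT : abstract_newton_tree T.

Lemma Q_ge1 p x : x \in vertices T -> child p x -> 1 <= Q x p.
Proof.
move=> xV px; apply: prod_ge1 => t /andP[xt tp]; apply: near_ge1 => //.
exact: child_of_adj px xt tp.
Qed.

Lemma Q2_ge1 p x z : x \in vertices T -> child p x -> 1 <= Q2 x p z.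
Proof.
move=> xV px; apply: prod_ge1 => t /and3P[xt tp _]; apply: near_ge1 => //.
exact: child_of_adj px xt tp.
Qed.

Lemma Q_root y : Q (v0 T) y = 1.
Proof. by rewrite /Q big1 // => t /andP[vt _]; rewrite near_root. Qed.

(** The first step from [y] towards a (1)-arrow above it. *)
Lemma good_child y : y \in vertices T -> exists2 c, child y c & c \notin arrows0 T.
Proof.
move=> yV; have [a aA] := ant1 HT yV; rewrite /below => /andP[ya].
rewrite gam_rev mem_rev => yin; have [|c yc cin] := gam_child yin; first by rewrite eq_sym.
exists c => //; apply/negP => c0; have [ca|/(gam_child cin)[c' + _]] := eqVneq a c.
  by apply: arrows01 aA _; rewrite ca.
by rewrite arrow_leaf // arrows0A.
Qed.

(** By induction from the leaves, since all decorations pointing away from the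
    root are at least 1. *)
Lemma branch_bounds x y : child x y ->
  0 <= branch x y /\ (y \notin arrows0 T -> 1 <= branch x y).
Proof.
have [n] := ubnP (#|cell T| - size (gam y (v0 T)))%N.
elim: n x y => [//|n IH] x y ny xy; have xy' := child_adj xy.
have [yA|yV] := boolP (y \in arrows T).
  have [y0|y1] := arrowsP yA; first by rewrite branch_arrow0 // y0.
  by rewrite branch_arrow1.
rewrite -VA in yV; rewrite branch_step ?V_arrows1 //.
have IH' z : adj y z && (z != x) ->
    0 <= branch y z /\ (z \notin arrows0 T -> 1 <= branch y z).
  move=> /andP[yz zx]; have cyz := child_of_adj xy yz zx.
  apply: (IH _ _ _ cyz); move: ny; rewrite (child_gam cyz) /=.
  have : (size (gam z (v0 T)) <= #|cell T|)%N.
    by rewrite -(card_uniqP (gam_uniq _ _)) max_card.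
  rewrite (child_gam cyz) /=; lia.
have [c yc c0] := good_child yV.
have yc' := child_adj yc.
have cx : c != x by apply: contraTneq yc => ->; rewrite childE ?(child_adjC xy) // xy.
rewrite (bigD1 c) /=; last by rewrite yc' cx.
have r0 : 0 <= \sum_(i | adj y i && (i != x) && (i != c)) Q2 y x i * branch y i.
  apply: sumr_ge0 => z /andP[/IH'[? _] _]; apply: mulr_ge0 => //.
  have := Q2_ge1 z yV xy; lia.
have [_ /(_ c0)] := IH' c (introT andP (conj yc' cx)).
have := Q2_ge1 c yV xy; move: r0; move: (\sum_(i | _) _) (Q2 y x c) (branch y c).
move=> s q B s0 q1 B1; have : 0 <= (q - 1) * (B - 1) by apply: mulr_ge0; lia.
split; nia.
Qed.

Lemma branch_ge0 x y : child x y -> 0 <= branch x y.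
Proof. by case/branch_bounds. Qed.

Lemma branch_ge1 x y : child x y -> y \notin arrows0 T -> 1 <= branch x y.
Proof. by case/branch_bounds. Qed.

Lemma child_V x y : child x y -> x \in vertices T.
Proof. by move=> xy; rewrite VA; apply/negP => xA; rewrite arrow_leaf in xy. Qed.

Hypothesis HM : minimally_complete T.

Lemma NV v : v \in Ncal T -> v \in vertices T.
Proof. by rewrite inE => /andP[]. Qed.

Lemma Npos v : v \in Ncal T -> 0 < Nmul v.
Proof. by rewrite inE => /andP[]. Qed.

Lemma dicrV u : u \in dicriticals T -> u \in vertices T.
Proof. by rewrite inE => /andP[]. Qed.

Lemma vertexP v : v \in vertices T -> v \in Ncal T \/ v \in dicriticals T.
Proof.
move=> vV; have := mc1_nneg HM vV.
by rewrite le_eqVlt eq_sym => /orP[] h; [right|left]; rewrite inE vV.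
Qed.

Lemma N_dicr u : u \in Ncal T -> u \in dicriticals T -> False.
Proof. by move=> /Npos h; rewrite inE => /andP[_ /eqP E]; rewrite E in h. Qed.

(** In [edge_identity] the right hand side is positive because det < 0, and
    N_y >= 0. *)
Lemma parent_N x y : child x y -> y \in vertices T -> x \in Ncal T.
Proof.
move=> xy yV; have xV := child_V xy; rewrite inE xV /=.
have := edge_identity (child_adj xy) (V_arrows1 xV) (V_arrows1 yV).
have := ant6 HT xV yV (child_adj xy); have := mc1_nneg HM yV.
have := near_ge1 HT xV xy; have := Q_ge1 yV xy.
have := branch_ge1 xy (V_arrows0 yV).
move: (edge_det x y) (branch _ _) (near _ _) (Q _ _) (Nmul y) (Nmul x) => d B q r n m.
move=> B1 r1 q1 n0 d0 E.
have E1 : 0 < B * - d by nia.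
have : 0 <= n * q by nia.
nia.
Qed.

Lemma root_N : v0 T \in Ncal T.
Proof.
rewrite inE v0V /= Nmul_branch ?V_arrows1 ?v0V //.
have [c vc c0] := good_child (v0V T).
rewrite (bigD1 c) ?(child_adj vc) //= Q_root mul1r ltr_wpDr //.
  apply: sumr_ge0 => z /andP[/child_v0 /branch_ge0 vz _].
  by rewrite Q_root mul1r.
have := branch_ge1 vc c0; lia.
Qed.

Lemma ancestor_N c v : v \in Ncal T -> c \in gam v (v0 T) -> c \in Ncal T.
Proof.
elim/rooted_ind: v => [|x y xy IH]; first by rewrite gamxx mem_seq1 => vN /eqP->.
move=> yN; rewrite (child_gam xy) in_cons => /orP[/eqP->//|]; apply: IH.
exact: parent_N xy (NV yN).
Qed.

Lemma dicr_neq_root u : u \in dicriticals T -> u != v0 T.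
Proof. by move=> uD; apply/eqP => E; apply: N_dicr root_N _; rewrite -E. Qed.

Lemma dicr_leaf u x : u \in dicriticals T -> child u x -> x \in arrows T.
Proof.
move=> uD ux; rewrite -[_ \in _]negbK -VA; apply/negP => xV.
exact: N_dicr (parent_N ux xV) uD.
Qed.

Lemma dicr_adj_arrow u x : u \in dicriticals T -> adj u x -> x \in arrows T \/ child x u.
Proof.
move=> uD ux; have [xu|xu] := boolP (child x u); first by right.
by left; apply: (dicr_leaf uD); rewrite childE.
Qed.

Lemma dicr_dead u : u \in dicriticals T -> exists2 b, b \in arrows0 T & adj u b.
Proof.
move=> uD; have [e eD ue] := mc2 HM uD.
by have [b [bA ub _]] := dead_endP (dicrV uD) eD ue; exists b.
Qed.

(** Near a dicritical vertex, only the dead end and the edge to the parent may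
    carry a decoration other than 1. *)
Lemma dicr_Q2 u p b z : u \in dicriticals T -> child p u -> b \in arrows0 T -> adj u b ->
  z != b -> Q2 u p z = near u b.
Proof.
move=> uD pu bA ub zb; rewrite /Q2 (bigD1 b) ?ub //=.
  rewrite big1 ?mulr1 // => t /andP[/and3P[ut tp tz] tb].
  apply: (near_dead HT (dicrV uD) bA ub) => //.
  exact: child_of_adj pu ut tp.
rewrite [b == z]eq_sym zb andbT; apply/eqP => bp; have := arrow_leaf u (arrows0A bA); by rewrite bp pu.
Qed.

Lemma dicr_Q u p b : u \in dicriticals T -> child p u -> b \in arrows0 T -> adj u b ->
  Q u p = near u b.
Proof.
move=> uD pu bA ub; rewrite -(dicr_Q2 uD pu bA ub (z := p)).
  by rewrite /Q /Q2; apply: eq_bigl => t; rewrite andbb.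
by apply/eqP => bp; have := arrow_leaf u (arrows0A bA); rewrite -bp pu.
Qed.

Lemma branch_dicr u p b : u \in dicriticals T -> child p u -> b \in arrows0 T -> adj u b ->
  branch p u = near u b * (degree u)%:Z.
Proof.
move=> uD pu bA ub; rewrite branch_step ?(child_adj pu) ?V_arrows1 ?dicrV //.
rewrite (bigID [in arrows1 T]) /= [X in _ + X]big1 ?addr0; last first.
  move=> z /andP[/andP[uz zp] z1].
  have [z0|z1'] := arrowsP (dicr_leaf uD (child_of_adj pu uz zp)).
    by rewrite (branch_arrow0 z0 uz) mulr0.
  by rewrite z1' in z1.
rewrite (eq_bigr (fun=> near u b)) => [|z /andP[/andP[uz zp] z1]]; last first.
  rewrite branch_arrow1 // mulr1; apply: dicr_Q2 => //.
  by apply/eqP => zb; apply: arrows01 z1 _; rewrite zb.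
rewrite sumr_const -mulr_natr natz; congr (_ * (Posz _)).
rewrite /degree cardsE; apply: eq_card => z; rewrite unfold_in /= [RHS]unfold_in /= andbC.
case z1: (z \in arrows1 T) => //=.
apply/andP/idP => [[]//|uz]; split=> //.
apply/eqP => zp; have := arrow_leaf u (arrows1A z1).
by rewrite zp pu.
Qed.

Lemma degree_gt0 u : u \in dicriticals T -> (0 < degree u)%N.
Proof.
move=> uD; have [c uc c0] := good_child (dicrV uD).
rewrite card_gt0; apply/set0Pn; exists c; rewrite inE (child_adj uc) andbT.
by have [|//] := arrowsP (dicr_leaf uD uc); rewrite (negbTE c0).
Qed.

(** This is [edge_identity] with N_u = 0, after cancelling the decoration of the
    dead end at [u]. *)
Lemma dicr_det u p : u \in dicriticals T -> child p u ->
  Nmul p = - edge_det p u * (degree u)%:Z.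
Proof.
move=> uD pu; have [b bA ub] := dicr_dead uD.
have uV := dicrV uD; have pV := child_V pu.
have := edge_identity (child_adj pu) (V_arrows1 pV) (V_arrows1 uV).
rewrite (branch_dicr uD pu bA ub) (dicr_Q uD pu bA ub).
have -> : Nmul u = 0 by move: uD; rewrite inE => /andP[_ /eqP].
have := near_ge1 HT uV (arrow_child (arrows0A bA) ub).
move: (near u b) (Nmul p) (edge_det p u) => n m d n1; rewrite mul0r subr0 => E.
apply: (@mulIf _ n); first by apply/eqP; lia.
rewrite E; ring.
Qed.

(** A (1)-arrow has a single neighbour, and that one is dicritical. *)
Lemma N_adj v x : v \in Ncal T -> adj v x ->
  [\/ x \in Ncal T, x \in dicriticals T | x \in arrows0 T].
Proof.
move=> vN vx; have [xA|xV] := boolP (x \in arrows T); last first.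
  by rewrite -VA in xV; have [] := vertexP xV; [constructor 1|constructor 2].
have [x0|x1] := arrowsP xA; first by constructor 3.
have [u uD xu] := mc1_arrow HM x1.
have xv : adj x v by rewrite adjC.
by case: (N_dicr vN); rewrite (arrow_adj xA xv xu).
Qed.

Definition buds v : {set cell T} := [set b in arrows0 T | adj v b].

End Complete.

(** * The vertices of positive multiplicity *)

Section NVertices.
Variable T : drtree.
Implicit Types (x y z u v w a b c p : cell T) (e : {set cell T}).
Hypothesis HT : abstract_newton_tree T.
Hypothesis HM : minimally_complete T.

Lemma NneighborsP v x : x \in Nneighbors v -> x \in Ncal T /\ adj v x.
Proof. by rewrite in_set => /andP. Qed.

Lemma dicr_atP v u : u \in dicr_at v -> u \in dicriticals T /\ adj v u.
Proof. by rewrite in_set => /andP. Qed.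

Lemma big_nbrs v (R : nmodType) (P : pred (cell T)) (F : cell T -> R) : v \in Ncal T ->
  \sum_(x | adj v x && P x) F x =
  \sum_(x in Nneighbors v | P x) F x + \sum_(x in dicr_at v | P x) F x
  + \sum_(x in buds v | P x) F x.
Proof.
move=> vN; rewrite big_mkcond [X in _ = X + _ + _]big_mkcond.
rewrite [X in _ = _ + X + _]big_mkcond [X in _ = _ + X]big_mkcond -!big_split /=.
apply: eq_bigr => x _.
rewrite [x \in Nneighbors v]in_set [x \in dicr_at v]in_set [x \in buds v]in_set.
case vx: (adj v x); rewrite ?andbF ?addr0 //= !andbT.
case: (P x); rewrite ?andbF ?addr0 //= !andbT.
have [xN|xD|x0] := N_adj HM vN vx.
- rewrite xN; case: ifP => [/(N_dicr xN)//|_].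
  by rewrite (negbTE (V_arrows0 (NV xN))) !addr0.
- rewrite xD (negbTE (V_arrows0 (dicrV xD))); case: ifP => [/N_dicr/(_ xD)//|_].
  by rewrite add0r addr0.
rewrite x0; case: ifP => [/NV/V_arrows0|_]; first by rewrite x0.
by case: ifP => [/dicrV/V_arrows0|_]; rewrite ?x0 // !add0r.
Qed.

Lemma card_sum1 (A : {set cell T}) : (#|A|)%:Z = \sum_(x in A) 1.
Proof. by rewrite sumr_const natz. Qed.

Lemma valency_N v : v \in Ncal T ->
  valency v = (eps v + #|dicr_at v| + #|buds v|)%N.
Proof.
move=> vN; apply/eqP; rewrite -eqz_nat !PoszD valencyE !card_sum1.
rewrite (eq_bigl (fun x => adj v x && predT x)) ?(big_nbrs _ _ vN) => [|x]; last first.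
  by rewrite inE andbT.
apply/eqP; congr (_ + _ + _); by apply: eq_bigl => x; rewrite andbT.
Qed.

Lemma rval_N v : v \in Ncal T -> rval v = (eps v + #|dicr_at v|)%N%:Z - 1.
Proof.
move=> vN; rewrite /rval; congr (_ - _); rewrite PoszD !card_sum1.
rewrite (eq_bigl (fun x => adj v x && (x \in vertices T))) => [|x]; last first.
  by rewrite inE andbC.
rewrite (big_nbrs _ _ vN) [X in _ + X]big_pred0 ?addr0 => [|x]; last first.
  by apply/negP => /andP[]; rewrite in_set => /andP[x0 _] /V_arrows0; rewrite x0.
congr (_ + _); apply: eq_bigl => x.
  by apply/andP/idP => [[]//|xv]; split=> //; case: (NneighborsP xv) => /NV.
by apply/andP/idP => [[]//|xv]; split=> //; case: (dicr_atP xv) => /dicrV.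
Qed.

Lemma amul_dead v b : v \in vertices T -> b \in arrows0 T -> adj v b ->
  amul v = near v b.
Proof.
move=> vV bA vb; rewrite /amul; case: pickP => [e /andP[eD ve]|/(_ [set v; b])].
  have [b' [bA' vb' ->]] := dead_endP vV eD ve.
  by rewrite (dead_unique HT vV bA' bA vb' vb).
by rewrite /= dead_endsE // bA set21.
Qed.

Lemma amul_nodead v : v \in vertices T -> buds v = set0 -> amul v = 1.
Proof.
move=> vV b0; rewrite /amul; case: pickP => // e /andP[eD ve].
have [b [bA vb _]] := dead_endP vV eD ve.
by move/setP/(_ b): b0; rewrite in_set bA vb in_set0.
Qed.

(** A dead end at [v] decorated by 1 would make [v] dicritical. *)
Lemma buds_N v : v \in Ncal T ->
  (buds v = set0 /\ amul v = 1) \/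
  exists b, [/\ buds v = [set b], b \in arrows0 T, adj v b, amul v = near v b & 2 <= amul v].
Proof.
move=> vN; have vV := NV vN.
have [b0|[b]] := set_0Vmem (buds v); first by left; rewrite amul_nodead.
rewrite in_set => /andP[bA vb]; right; exists b; rewrite (amul_dead vV bA vb); split=> //.
  apply/setP => b'; rewrite in_set in_set1; apply/andP/eqP => [[bA' vb']|->//].
  exact: (dead_unique HT vV).
have := near_ge1 HT vV (arrow_child (arrows0A bA) vb).
rewrite le_eqVlt => /orP[/eqP b1|//].
case: (N_dicr vN); apply: (mc3 HM (e := [set v; b])); rewrite ?dead_endsE ?set21 //.
Qed.

Lemma card_buds v : v \in Ncal T -> #|buds v| = (amul v != 1).
Proof.
move=> vN; have [[-> ->]|[b [-> _ _ _ a2]]] := buds_N vN; first by rewrite cards0.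
by rewrite cards1; case: eqP => // E; rewrite E in a2.
Qed.

Lemma amul_ge1 v : v \in Ncal T -> 1 <= amul v.
Proof. by move=> vN; have [[_ ->]|[b [_ _ _ _ a2]]] := buds_N vN => //; lia. Qed.

Lemma amul_root : amul (v0 T) = 1.
Proof.
have [[_ ->//]|[b [_ _ vb -> ]]] := buds_N (root_N HT).
by rewrite near_root.
Qed.

(** The edge of the dead end lies on no path from [v] to a (1)-arrow. *)
Lemma amul_dvd v : v \in Ncal T -> (amul v %| Nmul v)%Z.
Proof.
move=> vN; have [[_ ->]|[b [_ b0 vb -> _]]] := buds_N vN; first by rewrite dvd1z.
rewrite (Nmul_edge vb) ?V_arrows1 ?NV // (branch_arrow0 b0 vb) mulr0 add0r.
by rewrite dvdz_mulr.
Qed.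

Definition Nquot v : int := (Nmul v %/ amul v)%Z.

Lemma NquotE v : v \in Ncal T -> Nmul v = Nquot v * amul v.
Proof. by move=> vN; rewrite divzK // amul_dvd. Qed.

Lemma Nquot_bounds v : v \in Ncal T -> 1 <= Nquot v /\ Nquot v <= Nmul v.
Proof.
move=> vN; have := NquotE vN; have := Npos vN; have := amul_ge1 vN.
move: (Nquot v) (amul v) (Nmul v) => c a n a1 n0 E.
have c0 : 0 < c by nia.
split; nia.
Qed.

Lemma Nquot_half v : v \in Ncal T -> amul v = 1 \/ 2 * Nquot v <= Nmul v.
Proof.
move=> vN; have := NquotE vN; have [c1 _] := Nquot_bounds vN.
have [[_ ->]|[b [_ _ _ _ a2]]] := buds_N vN => E; [by left|right].
rewrite E; nia.
Qed.

(** Delta written as an integer, in a form where only the first summand can be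
    negative on N. *)
Definition DeltaZ v : int :=
  ((eps v)%:Z - 2) * (Nmul v - 1) + (Nmul v - Nquot v)
  + \sum_(u in dicr_at v) (Nmul v - (degree u)%:Z).

Lemma DeltaE v : v \in Ncal T -> Delta v = (DeltaZ v)%:~R.
Proof.
move=> vN; rewrite /Delta /DeltaZ rval_N // (NquotE vN).
have a0 : (amul v)%:~R != 0 :> rat by rewrite intr_eq0; have := amul_ge1 vN; lia.
have -> : (Nquot v * amul v)%:~R * (1 - 1 / (amul v)%:~R) = (Nquot v * amul v - Nquot v)%:~R :> rat.
  by rewrite rmorphB /= rmorphM /=; field.
have -> : \sum_(u in dicr_at v) ((degree u)%:R - 1) = (\sum_(u in dicr_at v) ((degree u)%:Z - 1))%:~R :> rat.
  by rewrite rmorph_sum; apply: eq_bigr => u _; rewrite rmorphB.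
rewrite -intrM -intrD -intrB; congr (_%:~R).
rewrite !big_split /= !sumr_const !sumrN PoszD.
rewrite -[-1 *+ _]mulr_natr -[_ * _ *+ _]mulr_natr !natz.
move: (\sum_(u in _) _) (Posz (eps v)) (Posz #|_|) (Nquot v) (amul v) => *; ring.
Qed.

(** A vertex other than the root has valency neither 1 nor 2. *)
Lemma valency_ge3 v : v \in Ncal T -> v != v0 T ->
  (3 <= eps v + #|dicr_at v| + (amul v != 1))%N.
Proof.
move=> vN vr; rewrite -card_buds // -valency_N //.
have := mc4 HM (NV vN) vr; have := NV vN; rewrite VA !inE vr /=.
have : (0 < valency v)%N.
  by rewrite valencyE card_gt0; apply/set0Pn; exists (parent v); rewrite inE (child_adjC (child_parent vr)).
by case: (valency v) => [|[|[]]].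
Qed.

Lemma Q2_ge_amul p v z : v \in Ncal T -> child p v -> z \notin arrows0 T ->
  amul v <= Q2 v p z.
Proof.
move=> vN pv z0; have vV := NV vN.
have [[_ ->]|[b [_ b0 vb -> a2]]] := buds_N vN; first exact: (Q2_ge1 HT).
rewrite /Q2 (bigD1 b) ?vb /=; last first.
  rewrite andbC; apply/andP; split; first by apply: contraNneq z0 => <-.
  by apply/eqP => bp; have := arrow_leaf v (arrows0A b0); rewrite bp pv.
rewrite ler_peMr //; last first.
  apply: prod_ge1 => t /andP[/and3P[vt tp _] _]; apply: (near_ge1 HT) => //.
  exact: child_of_adj pv vt tp.
by have := near_ge1 HT vV (arrow_child (arrows0A b0) vb); lia.
Qed.

Lemma branch_dicr_ge u p : u \in dicriticals T -> child p u ->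
  (degree u)%:Z <= branch p u.
Proof.
move=> uD pu; have [b b0 ub] := dicr_dead HM uD.
rewrite (branch_dicr HT HM uD pu b0 ub).
have := near_ge1 HT (dicrV uD) (arrow_child (arrows0A b0) ub); nia.
Qed.

Lemma dicr_at_child v u : v \in Ncal T -> u \in dicr_at v -> child v u.
Proof.
move=> vN /dicr_atP[uD vu]; rewrite childE //; apply/negP => uv.
exact: N_dicr (parent_N HT HM uv (NV vN)) uD.
Qed.

Lemma branch_N v x : v \in Ncal T -> adj x v ->
  branch x v = \sum_(z in Nneighbors v | z != x) Q2 v x z * branch v z
             + \sum_(u in dicr_at v | u != x) Q2 v x u * branch v u.
Proof.
move=> vN xv; rewrite branch_step ?V_arrows1 ?NV // (big_nbrs _ _ vN).
rewrite [X in _ + X]big1 ?addr0 // => b; rewrite in_set => /andP[/andP[b0 vb] _].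
by rewrite (branch_arrow0 b0 vb) mulr0.
Qed.

(** Every path from [p] to an arrow adjacent to a dicritical [u] in D_v meets the
    dead end at [v], and the remaining decorations are at least 1. *)
Lemma branch_lb p v : v \in Ncal T -> child p v ->
  amul v * \sum_(u in dicr_at v) (degree u)%:Z + (#|Nneighbors v :\ p|)%:Z <= branch p v.
Proof.
move=> vN pv; have vV := NV vN; rewrite branch_N ?(child_adj pv) // addrC.
apply: lerD.
  rewrite (card_sum1 (Nneighbors v :\ p)).
  rewrite (eq_bigl (fun z => (z \in Nneighbors v) && (z != p))) => [|z]; last first.
    by rewrite in_setD1 andbC.
  apply: ler_sum => z /andP[zv zp]; have [zN vz] := NneighborsP zv.
  have := Q2_ge1 HT z vV pv.
  have := branch_ge1 HT (child_of_adj pv vz zp) (V_arrows0 (NV zN)).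
  nia.
rewrite mulr_sumr [X in _ <= X](eq_bigl (fun u => u \in dicr_at v)) => [|u]; last first.
  apply/andP/idP => [[]//|uv]; split=> //; have [uD vu] := dicr_atP uv.
  by apply/eqP => up; have := N_dicr (parent_N HT HM pv vV); rewrite -up; apply.
apply: ler_sum => u uv; have [uD vu] := dicr_atP uv.
have := Q2_ge_amul vN pv (V_arrows0 (dicrV uD)).
have := branch_dicr_ge uD (dicr_at_child vN uv).
have := amul_ge1 vN => a1 kB aq; apply: ler_pM => //; lia.
Qed.

(** By valency, [c] has two children; if one is a (0)-arrow the other has
    decoration 1 by [near_dead], otherwise [near_one] applies. *)
Lemma unit_child p c : c \in Ncal T -> child p c ->
  exists x, [/\ child c x, x \notin arrows0 T & near c x = 1].
Proof.
move=> cN pc; have cV := NV cN.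
have c0 : c != v0 T by apply: contraTneq pc => ->; rewrite child_root.
have : (1 < #|[set y | adj c y] :\ p|)%N.
  have := valency_ge3 cN c0; rewrite -card_buds // -valency_N // valencyE.
  by rewrite (cardsD1 p) inE (child_adjC pc).
case/card_gt1P => x [y [+ + xy]]; rewrite !inE => /andP[xp cx] /andP[yp cy].
have cx' := child_of_adj pc cx xp; have cy' := child_of_adj pc cy yp.
have [x0|x0] := boolP (x \in arrows0 T).
  have yx : y != x by rewrite eq_sym.
  exists y; split=> //; last exact: (near_dead HT cV x0 cx).
  by apply: contra xy => y0; rewrite (dead_unique HT cV x0 y0).
have [y0|y0] := boolP (y \in arrows0 T).
  exists x; split=> //; exact: (near_dead HT cV y0 cy).
by have [E|E] := near_one HT cV cx' cy' xy; [exists x|exists y].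
Qed.

(** The arrows above a child whose edge is decorated by 1 already contribute all
    the other decorations near [c]. *)
Lemma branch_ge_Q p c : c \in Ncal T -> child p c -> Q c p <= branch p c.
Proof.
move=> cN pc; have cV := NV cN; have [x [cx x0 x1]] := unit_child cN pc.
have xp : x != p by apply: contraTneq cx => ->; rewrite childE ?(child_adjC pc) // pc.
rewrite branch_step ?(child_adj pc) ?V_arrows1 // (bigD1 x) /= ?(child_adj cx) //.
rewrite (Q_Q2 (child_adj cx) xp) x1 mul1r.
have : 0 <= \sum_(i | adj c i && (i != p) && (i != x)) Q2 c p i * branch c i.
  apply: sumr_ge0 => i /andP[/andP[ci ip] _]; apply: mulr_ge0.
    by have := Q2_ge1 HT i cV pc; lia.
  by apply: (branch_ge0 HT); apply: child_of_adj pc ci ip.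
have := branch_ge1 HT cx x0; have := Q2_ge1 HT x cV pc.
move: (\sum_(i | _) _) (branch _ _) (Q2 _ _ _) => s B q q1 B1 s0; nia.
Qed.

(** With B = [branch x c] >= Q = [Q c x], [edge_identity] gives
    N_x Q >= N_c q(e, x) + B > Q. *)
Lemma Nmul_ge2 x c : c \in Ncal T -> child x c -> 2 <= Nmul x.
Proof.
move=> cN xc; have cV := NV cN; have xV := child_V xc.
(* det <= -1, so the right hand side of the identity is at least B *)
have := edge_identity (child_adj xc) (V_arrows1 xV) (V_arrows1 cV).
have := ant6 HT xV cV (child_adj xc); have := Npos cN.
have := near_ge1 HT xV xc; have := Q_ge1 HT cV xc.
have := branch_ge_Q cN xc.
move: (edge_det x c) (branch _ _) (near _ _) (Q _ _) (Nmul c) (Nmul x) => d B q r n m.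
move=> rB r1 q1 n0 d0 E.
have E1 : r <= B * - d by nia.
have E2 : 1 <= n * q by nia.
have : r < m * r by lia.
nia.
Qed.

Lemma degree_dvd v u : v \in Ncal T -> u \in dicr_at v ->
  exists k : nat, Nmul v = (k * degree u)%N%:Z.
Proof.
move=> vN uv; have [uD vu] := dicr_atP uv.
have := dicr_det HT HM uD (dicr_at_child vN uv); have := Npos vN.
have := degree_gt0 HT HM uD.
move: (edge_det v u) (degree u) (Nmul v) => d k n k0 n0 E.
exists `|d|%N; have : d < 0 by nia.
rewrite E; lia.
Qed.

Lemma Nmul_root : Nmul (v0 T) =
  \sum_(z in Nneighbors (v0 T)) branch (v0 T) z + \sum_(u in dicr_at (v0 T)) branch (v0 T) u.
Proof.
rewrite Nmul_branch ?V_arrows1 ?v0V //.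
rewrite (eq_bigl (fun x => adj (v0 T) x && predT x)) => [|x]; last by rewrite andbT.
rewrite (big_nbrs _ _ (root_N HT)) [X in _ + X]big1 ?addr0 => [|b]; last first.
  by rewrite andbT in_set => /andP[b0 vb]; rewrite (branch_arrow0 b0 vb) mulr0.
by congr (_ + _); apply: eq_big => [x|x _]; rewrite ?andbT // (Q_root HT) mul1r.
Qed.

End NVertices.

(** * Types of nodes, leaves and inner vertices *)

Section Types.
Variable T : drtree.
Implicit Types (x y z u v w a b c p : cell T) (e : {set cell T}).
Hypothesis HT : abstract_newton_tree T.
Hypothesis HM : minimally_complete T.
Hypothesis Hgcd : nodes T = nodes_star T.

Lemma type_gcd v (g : nat) : v \in Ncal T -> dicr_at v != set0 ->
  (forall u, u \in dicr_at v -> (g %| degree u)%N) -> g = 1%N.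
Proof.
move=> vN D0 gD; have : v \in nodes_star T by rewrite -Hgcd in_set vN.
rewrite in_set => /andP[_ /eqP g1]; apply/eqP; rewrite -dvdn1 -g1 big_seq.
elim/big_ind: _ => [//|x y gx gy|d]; first by rewrite dvdn_gcd gx.
by rewrite mem_sort => /mapP[u]; rewrite mem_enum => uv ->; exact: gD.
Qed.

(** The degree of [u] is a divisor of N_v, by [dicr_det]. *)
Lemma degree_half v u : v \in Ncal T -> u \in dicr_at v ->
  [/\ (1 <= degree u)%N, (degree u)%:Z <= Nmul v &
      (degree u)%:Z = Nmul v \/ 2 * (degree u)%:Z <= Nmul v].
Proof.
move=> vN uv; have [k E] := degree_dvd HT HM vN uv; have := Npos vN.
have := degree_gt0 HT HM (dicr_atP uv).1.
case: k E => [|[|k]] E d0 n0; split; try lia; nia.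
Qed.

(** The shape [1, N_v, ..., N_v] of a type, with the entry 1 coming from [u]. *)
Definition one_full v u := [/\ u \in dicr_at v, degree u = 1%N
  & forall t, t \in dicr_at v -> t != u -> (degree t)%:Z = Nmul v].

(** If only one entry differs from N_v then it divides all entries, and is 1
    because the type has gcd 1.  For N_v = 1 all entries are 1. *)
Lemma type_cases v : v \in Ncal T -> dicr_at v != set0 ->
  (exists u, one_full v u) \/
  (exists u t, [/\ u \in dicr_at v, t \in dicr_at v, u != t,
     2 * (degree u)%:Z <= Nmul v & 2 * (degree t)%:Z <= Nmul v]).
Proof.
move=> vN D0; have [u0 u0v] := set0Pn _ D0.
have [n1|n2] : Nmul v = 1 \/ 2 <= Nmul v by have := Npos vN; lia.
  have d1 t : t \in dicr_at v -> degree t = 1%N.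
    by case/(degree_half vN); rewrite n1; lia.
  by left; exists u0; split=> [//||t tv _]; rewrite ?n1 d1.
have [u /andP[uv du]|allN] := pickP (fun u => (u \in dicr_at v) && ((degree u)%:Z != Nmul v)).
  have [t /and3P[tv tu dt]|oneN] := pickP
    (fun t => [&& t \in dicr_at v, t != u & (degree t)%:Z != Nmul v]).
    right; exists u, t; split=> //; first by rewrite eq_sym.
      by case: (degree_half vN uv) => _ _ []//; move/eqP: du.
    by case: (degree_half vN tv) => _ _ []//; move/eqP: dt.
  have full t : t \in dicr_at v -> t != u -> (degree t)%:Z = Nmul v.
    by move=> tv tu; apply/eqP/negPn; have := oneN t; rewrite tv tu /= => ->.
  left; exists u; split=> //; apply: (type_gcd vN D0) => t tv.
  have [->//|tu] := eqVneq t u.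
  (* the entry d_u divides N_v, which is the value of every other entry *)
  have [k E] := degree_dvd HT HM vN uv; have := full t tv tu; rewrite E.
  by move=> [->]; rewrite dvdn_mull.
have full t : t \in dicr_at v -> (degree t)%:Z = Nmul v.
  by move=> tv; apply/eqP/negPn; have := allN t; rewrite tv /= => ->.
have : degree u0 = 1%N.
  apply: (type_gcd vN D0) => t tv; suff -> : degree t = degree u0 by [].
  by have := full t tv; rewrite -(full u0 u0v) => -[].
by have := full u0 u0v; lia.
Qed.

Lemma node_type_one_full v u : v \in Ncal T -> one_full v u ->
  node_type v = 1%N :: nseq #|dicr_at v :\ u| `|Nmul v|%N.
Proof.
move=> vN [uv u1 full]; have n0 := Npos vN.
apply: (sorted_eq leq_trans anti_leq).
- exact: (sort_sorted leq_total).
- rewrite /= path_min_sorted; last by apply/allP => d /nseqP[->]; lia.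
  elim: #|_| => [//|k IHk] /=; rewrite path_min_sorted //.
  by apply/allP => d /nseqP[->].
rewrite /node_type perm_sort.
apply: (@perm_trans _ [seq degree t | t <- u :: enum (dicr_at v :\ u)]).
  apply: perm_map; apply: uniq_perm; rewrite ?enum_uniq //=.
    by rewrite mem_enum in_setD1 eqxx enum_uniq.
  move=> t; rewrite in_cons !mem_enum in_setD1.
  by have [->|] := eqVneq t u.
rewrite /= u1 perm_cons cardE.
have : {in enum (dicr_at v :\ u), forall t, degree t = `|Nmul v|%N}.
  move=> t; rewrite mem_enum in_setD1 => /andP[tu tv].
  by rewrite -(full t tv tu).
elim: (enum _) => [//|t s IHs] /= H.
by rewrite H ?mem_head // perm_cons IHs // => r rs; apply: H; rewrite in_cons rs orbT.
Qed.

Lemma one_full_type v u : v \in Ncal T -> one_full v u -> type_1N v.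
Proof.
move=> vN vu; exists #|dicr_at v :\ u|; rewrite (node_type_one_full vN vu) /= map_nseq.
by have := Npos vN => n0; rewrite gtz0_abs.
Qed.

Lemma defect_ge0 v : v \in Ncal T ->
  0 <= \sum_(u in dicr_at v) (Nmul v - (degree u)%:Z).
Proof.
move=> vN; apply: sumr_ge0 => u /(degree_half vN)[_ ? _]; lia.
Qed.

Lemma defect_one_full v u : one_full v u ->
  \sum_(t in dicr_at v) (Nmul v - (degree t)%:Z) = Nmul v - 1.
Proof.
move=> [uv u1 full]; rewrite (bigD1 u) //= u1 big1 ?addr0 // => t /andP[tv tu].
by rewrite full // subrr.
Qed.

Lemma defect_two v u t : v \in Ncal T -> u \in dicr_at v -> t \in dicr_at v -> u != t ->
  (Nmul v - (degree u)%:Z) + (Nmul v - (degree t)%:Z) <=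
  \sum_(t in dicr_at v) (Nmul v - (degree t)%:Z).
Proof.
move=> vN uv tv ut; rewrite (bigD1 u) //= (bigD1 t) /=; last by rewrite tv eq_sym.
rewrite addrA lerDl; apply: sumr_ge0 => r /andP[/andP[/(degree_half vN)[_ ? _] _] _].
lia.
Qed.

Lemma defect_node v : v \in Ncal T -> dicr_at v != set0 ->
  (exists u, one_full v u) \/
  Nmul v <= \sum_(t in dicr_at v) (Nmul v - (degree t)%:Z).
Proof.
move=> vN /(type_cases vN)[|[u [t [uv tv ut du dt]]]]; first by left.
right; have := defect_two vN uv tv ut; lia.
Qed.

(** Here Delta = 1 - N_v/a_v + sum (N_v - d_u).  For the type
    [1, N_v, ..., N_v] this is N_v (1 - 1/a_v); otherwise two entries are at most
    N_v/2 and Delta >= 1. *)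
Lemma leaf_DeltaZ v : v \in Ncal T -> eps v = 1%N -> dicr_at v != set0 ->
  0 <= DeltaZ v /\ (DeltaZ v <= 0 -> [/\ DeltaZ v = 0, amul v = 1 & exists u, one_full v u]).
Proof.
move=> vN e1 D0; rewrite /DeltaZ e1; have [c1 cN] := Nquot_bounds HT HM vN.
have [[u vu]|dN] := defect_node vN D0.
  rewrite (defect_one_full vu).
  split=> [|c0]; first by lia.
  have [a1|] := Nquot_half HT HM vN; last by lia.
  by split=> //; [lia|exists u].
by lia.
Qed.

Lemma eps_ge1 v : v \in Ncal T -> v != v0 T -> (0 < eps v)%N.
Proof.
move=> vN v0'; have pv := child_parent v0'; rewrite card_gt0; apply/set0Pn.
by exists (parent v); rewrite inE (child_adjC pv) (parent_N HT HM pv (NV vN)).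
Qed.

Lemma leaf_dicr v : v \in Ncal T -> v != v0 T -> eps v = 1%N -> dicr_at v != set0.
Proof.
move=> vN vr e1; have := valency_ge3 HT HM vN vr; rewrite e1 -card_gt0.
by case: (amul v != 1) => /=; lia.
Qed.

Lemma eps_child v : v \in Ncal T -> (1 < eps v)%N -> exists2 c, c \in Ncal T & child v c.
Proof.
move=> vN /card_gt1P[x [y [/NneighborsP[xN vx] /NneighborsP[yN vy] xy]]].
have [xv|xv] := boolP (child x v); last by exists x => //; rewrite (childE vx).
exists y => //; rewrite (childE vy); apply: contraNN xy => yv.
by rewrite (child_inj xv yv).
Qed.

(** A child in N forces N_v >= 2.  For eps(v) >= 3 the first term of Delta is
    then positive; for eps(v) = 2 the valency condition provides a dead end,
    with a_v >= 2, or a dicritical neighbour. *)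
Lemma inner_DeltaZ v : v \in Ncal T -> v != v0 T -> (1 < eps v)%N -> 0 < DeltaZ v.
Proof.
move=> vN vr e2; have [c cN vc] := eps_child vN e2.
have n2 := Nmul_ge2 HT HM cN vc; have [c1 cN'] := Nquot_bounds HT HM vN.
have := valency_ge3 HT HM vN vr; have := defect_ge0 vN.
rewrite /DeltaZ; have [e3|e3] := leqP 3 (eps v).
  have : 1 <= ((eps v)%:Z - 2) * (Nmul v - 1) by nia.
  by move: (\sum_(u in _) _) => s ? s0 _; lia.
have -> : eps v = 2%N by lia.
have [D0|D0] := eqVneq (dicr_at v) set0.
  rewrite D0 cards0 => s0; have [->//|] := Nquot_half HT HM vN; lia.
have [[u vu]|dN] := defect_node vN D0; first by rewrite (defect_one_full vu); lia.
lia.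
Qed.

(** An interior vertex of a path in Gamma has eps = 2 and Delta = 0, so it is the
    root by [inner_DeltaZ].  The last interior vertex is a descendant of the end
    of the path, hence is not the root: there are no interior vertices. *)
Lemma Gamma_gam v w : Gamma (gam v w) <->
  [/\ v \in Ncal T, eps v = 1%N, DeltaZ v <= 0, child w v & 0 < DeltaZ w].
Proof.
have DS : child w v -> v \in Ncal T -> w \in Ncal T ->
    DeltaS [set x in [:: v; w]] = (DeltaZ v + DeltaZ w)%:~R.
  move=> wv vN wN; rewrite intrD -!(DeltaE HT HM) // /DeltaS.
  rewrite (_ : [set x in _] = v |: [set w]); last by apply/setP => x; rewrite !inE.
  by rewrite big_setU1 ?big_set1 // in_set1 eq_sym (child_neq wv).
have leaf0 : v \in Ncal T -> eps v = 1%N -> DeltaZ v <= 0 -> v != v0 T -> DeltaZ v = 0.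
  move=> vN e1 d0 vr; have [_ /(_ d0)[]//] := leaf_DeltaZ vN e1 (leaf_dicr vN vr e1).
split; last first.
  case=> vN e1 d0 wv dw; have wN := parent_N HT HM wv (NV vN).
  have vr : v != v0 T by apply: contraTneq wv => ->; rewrite child_root.
  have vw := child_adjC wv.
  rewrite (gam_cons vw) ?gamxx; last by rewrite mem_seq1 (adj_neq vw).
  apply/and4P; split.
  - apply/and5P; split=> //=.
    + by rewrite /is_path /= vw mem_seq1 (adj_neq vw).
    + by rewrite vN wN.
    + by rewrite e1.
    + by apply/forallP => -[[|[]]].
  - by rewrite /= (DeltaE HT HM) // lerz0.
  - by rewrite DS // ltr0z leaf0 // add0r.
  - by rewrite /= below_child // child_adj.
have := gam_path v w.
case gE: (gam v w) => [//|v' p] /and3P[pp /eqP/= E /eqP/= wE].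
rewrite {v'}E in gE pp wE *; case/and4P=> /and5P[_ allN s2 /eqP/= e1 /forallP tr] /= d0 dS.
case/lastP: p wE gE pp allN s2 tr dS => [//|p w'] /=.
rewrite last_rcons => ->; case/lastP: p => [|p x] gE pp allN _ tr dS.
  move=> /= bvw; case/andP: allN => vN /andP[wN _].
  move: pp; rewrite /is_path /= => /andP[/andP[vw _] _].
  have wv : child w v by rewrite -below_child // adjC.
  have vr : v != v0 T by apply: contraTneq wv => ->; rewrite child_root.
  have d0' : DeltaZ v <= 0 by rewrite -(@lerz0 rat) -(DeltaE HT HM).
  split=> //; move: dS; rewrite DS // leaf0 // add0r ltr0z //.
have szE : (size (v :: rcons (rcons p x) w)).-2 = (size p).+1 by rewrite /= !size_rcons.
rewrite szE.
(* the last interior vertex of the path *)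
have nthE : nth (v0 T) (v :: rcons (rcons p x) w) (size p).+1 = x.
  by rewrite /= nth_rcons size_rcons ltnSn nth_rcons ltnn eqxx.
rewrite nthE /= => bwx.
have lt : ((size p).+1 < size (v :: rcons (rcons p x) w))%N by rewrite /= !size_rcons.
have := tr (Ordinal lt); rewrite nthE /= !size_rcons /= ltnSn /=.
case/andP=> /eqP e2 /eqP dx.
have xN : x \in Ncal T.
  have /allP/(_ x) := (allN : all [in Ncal T] (v :: rcons (rcons p x) w)).
  by apply; rewrite in_cons mem_rcons in_cons mem_rcons in_cons eqxx !orbT.
have xr : x != v0 T.
  apply: contraTneq bwx => ->; rewrite /below gamxx mem_seq1.
  by case: eqP.
have := inner_DeltaZ xN xr; rewrite e2 => /(_ isT).
by rewrite -(ltr0z rat) -(DeltaE HT HM) // dx ltxx.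
Qed.

(** The vertices that the construction of S(T) and Omega(T) removes, provided
    that their parents have Delta > 0. *)
Definition light_leaves : {set cell T} :=
  [set v in Ncal T | [&& v != v0 T, eps v == 1%N & DeltaZ v <= 0]].

Lemma light_leavesP v : reflect [/\ v \in Ncal T, v != v0 T, eps v = 1%N & DeltaZ v <= 0]
  (v \in light_leaves).
Proof. by rewrite [_ \in light_leaves]in_set; apply: (iffP and4P) => -[-> -> /eqP -> ->]. Qed.

Lemma VsetP v w : reflect [/\ v \in light_leaves, child w v & 0 < DeltaZ w] (v \in Vset w).
Proof.
rewrite [_ \in Vset w]in_set; apply: (iffP idP) => [/Gamma_gam[vN e1 d0 wv dw]|[/light_leavesP[]]].
  split=> //; apply/light_leavesP; split=> //.
  by apply: contraTneq wv => ->; rewrite child_root.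
by move=> vN _ e1 d0 wv dw; apply/Gamma_gam.
Qed.

Lemma Wset_Vset v w : v \in Vset w -> w \in Wset T.
Proof. by rewrite in_set => G; rewrite in_set; apply/existsP; exists v. Qed.

Section Absorbed.
Hypothesis parent_pos : forall v, v \in light_leaves -> 0 < DeltaZ (parent v).

Lemma bigcup_Vset : \bigcup_(w in Wset T) Vset w = light_leaves.
Proof.
apply/setP => v; apply/bigcupP/idP => [[w _ /VsetP[]//]|vL].
have vV : v \in Vset (parent v).
  by apply/VsetP; split=> //; [apply: child_parent; case/light_leavesP: vL | exact: parent_pos].
by exists (parent v) => //; exact: Wset_Vset vV.
Qed.

Lemma skeletonE : skeleton T = Ncal T :\: light_leaves.
Proof.
rewrite /skeleton -bigcup_Vset; congr (_ :\: _); apply: eq_bigr => w wW.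
rewrite /Vbar wW; apply/setP => x; rewrite in_setD1.
apply/andP/idP => [[xw /bigcupP[v vV]]|xV].
  have /VsetP[_ wv _] := vV; have vw := child_adjC wv.
  rewrite in_set (gam_cons vw) ?gamxx ?mem_seq1 ?(adj_neq vw) // !in_cons (negbTE xw).
  by rewrite orbF => /eqP->.
have /VsetP[_ wx _] := xV; split; first by rewrite eq_sym (child_neq wx).
by apply/bigcupP; exists x => //; rewrite in_set mem_gam_l.
Qed.
End Absorbed.

Lemma ZsetE : v0 T \in Zset T -> Zset T = v0 T |: light_leaves.
Proof.
move=> vZ; apply/setP => x; rewrite in_setU1; have [->//|xr] /= := eqVneq x (v0 T).
apply/idP/light_leavesP => [|[xN _ e1 d0]]; rewrite in_set.
  case/and3P=> xN /eqP e1; rewrite (DeltaE HT HM) // lerz0; by split.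
by rewrite xN e1 (DeltaE HT HM) // lerz0 d0.
Qed.

Lemma light_leaf_one_full v : v \in light_leaves ->
  [/\ DeltaZ v = 0, amul v = 1 & exists u, one_full v u].
Proof.
case/light_leavesP=> vN vr e1 d0; have [_ /(_ d0)] := leaf_DeltaZ vN e1 (leaf_dicr vN vr e1).
by [].
Qed.

Lemma nonroot_DeltaZ v : v \in Ncal T -> v != v0 T -> 0 <= DeltaZ v.
Proof.
move=> vN vr; have := eps_ge1 vN vr; rewrite leq_eqVlt => /orP[/eqP e1|e2].
  by have [] := leaf_DeltaZ vN (esym e1) (leaf_dicr vN vr (esym e1)).
by apply: ltW; exact: inner_DeltaZ.
Qed.

Lemma nonroot_DeltaZ0 v : v \in Ncal T -> v != v0 T -> DeltaZ v <= 0 -> v \in light_leaves.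
Proof.
move=> vN vr d0; apply/light_leavesP; split=> //.
have := eps_ge1 vN vr; rewrite leq_eqVlt => /orP[/eqP //|e2].
by have := inner_DeltaZ vN vr e2; lia.
Qed.

(** The only neighbour of [v] in N is its parent. *)
Lemma leaf_desc v x : v \in Ncal T -> v != v0 T -> eps v = 1%N ->
  x \in Ncal T -> v \in gam x (v0 T) -> x = v.
Proof.
move=> vN vr e1 xN vx; apply/eqP; apply/negPn/negP => /(gam_child vx)[c vc cx].
have cN := ancestor_N HT HM xN cx.
have pv := child_parent vr; have pN := parent_N HT HM pv (NV vN).
suff : (1 < eps v)%N by rewrite e1.
have nb y : y \in Ncal T -> adj v y -> y \in Nneighbors v.
  by move=> yN vy; rewrite in_set yN.
apply/card_gt1P; exists c, (parent v); split; rewrite ?nb ?(child_adj vc) ?(child_adjC pv) //.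
apply: contraTneq vc => ->; by rewrite childE ?(child_adjC pv) // pv.
Qed.

End Types.

(** * A root isolated in N *)

Section Elementary.
Variable T : drtree.
Implicit Types (x y z u v w a b c p : cell T) (e : {set cell T}).
Hypothesis HT : abstract_newton_tree T.
Hypothesis HM : minimally_complete T.
Hypothesis Hgcd : nodes T = nodes_star T.
Hypothesis HD : \sum_(v in Ncal T) DeltaZ v = 0.

Lemma parent_child x y : child x y -> parent y = x.
Proof.
move=> xy; apply: (child_inj _ xy); apply: child_parent.
by apply: contraTneq xy => ->; rewrite child_root.
Qed.

Lemma edgesP e : reflect (exists2 y, y != v0 T & e = [set parent y; y]) (e \in edges T).
Proof.
apply: (iffP idP) => [eT|[y yr ->]]; last by have := child_adj (child_parent yr); rewrite /adj.
have [x xe] : exists x, x \in e by apply/card_gt0P; rewrite (edge_card eT).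
have nr x' y' : child x' y' -> y' != v0 T by apply: contraTneq => ->; rewrite child_root.
have [y xy ->] := edgeP eT xe; have [c|c] := boolP (child x y).
  by exists y; rewrite ?(nr _ _ c) // (parent_child c).
have {}c : child y x by rewrite childE // adjC.
by exists x; rewrite ?(nr _ _ c) // (parent_child c) setUC.
Qed.

Lemma root_no_bud b : b \in arrows0 T -> adj (v0 T) b -> False.
Proof.
move=> b0 vb; have [[E _]|[b' [_ _ vb' -> ]]] := buds_N HT HM (root_N HT).
  by have := in_set0 b; rewrite -E in_set b0 vb.
by rewrite near_root.
Qed.

Lemma degree1 u : u \in dicriticals T -> degree u = 1%N ->
  exists al be, [/\ al \in arrows1 T, be \in arrows0 T, adj u al, adj u be &
    forall x, adj u x -> [\/ x = parent u, x = al | x = be]].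
Proof.
move=> uD /eqP/cards1P[al alE]; have [be b0 ub] := dicr_dead HM uD.
have : al \in [set al] by rewrite set11.
rewrite -alE in_set => /andP[a1 ua]; exists al, be; split=> // x ux.
have [xA|xu] := dicr_adj_arrow HT HM uD ux; last by rewrite (parent_child xu); constructor 1.
have [x0|x1] := arrowsP xA.
  by constructor 3; apply: (dead_unique HT (dicrV uD)).
constructor 2; apply/eqP; rewrite -in_set1 -alE in_set.
by rewrite x1 ux.
Qed.

Lemma near_arrow a x : a \in arrows T -> adj a x -> near a x = 1.
Proof. by move=> aA ax; apply: (ant4 HT) => //; rewrite set21. Qed.

Lemma near_arrow1 u al be : u \in dicriticals T -> al \in arrows1 T ->
  be \in arrows0 T -> adj u al -> adj u be -> near u al = 1.
Proof.
move=> uD a1 b0 ua ub; apply: (near_dead HT (dicrV uD) b0 ub).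
  by apply: arrow_child => //; exact: arrows1A.
by apply: contraTneq b0 => <-; apply/negP => /(arrows01 a1).
Qed.

Lemma deco1 a : a \in arrows1 T -> deco a.
Proof. by rewrite in_setD [_ \in arrows0 T]in_set; case: (deco a); rewrite ?andbF ?andbT //= andNb. Qed.

Lemma deco0 b : b \in arrows0 T -> ~~ deco b.
Proof. by rewrite in_set => /andP[]. Qed.

Hypothesis e0 : eps (v0 T) = 0%N.

Lemma Nneighbors_root0 : Nneighbors (v0 T) = set0.
Proof. by apply/eqP; rewrite -cards_eq0; apply/eqP. Qed.

Lemma Ncal_root : Ncal T = [set v0 T].
Proof.
apply/setP => x; rewrite in_set1; apply/idP/eqP => [xN|->]; last exact: root_N.
apply/eqP/negPn/negP => /(gam_child (v0_gam x))[c vc cx].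
have cN := ancestor_N HT HM xN cx.
have : c \in Nneighbors (v0 T) by rewrite in_set cN (child_adj vc).
by rewrite Nneighbors_root0 in_set0.
Qed.

Lemma Omega_root : Omega T = set0.
Proof.
apply/setP => x; rewrite in_set0; apply/negP => /setDP[]; rewrite in_set Ncal_root in_set1.
by case/and3P=> /eqP->; rewrite e0.
Qed.

Lemma cell_root x : [\/ x = v0 T, x \in dicr_at (v0 T)
  | exists u, [/\ u \in dicr_at (v0 T), adj u x & x \in arrows T]].
Proof.
have dP u : u \in dicriticals T -> u \in dicr_at (v0 T).
  move=> uD; rewrite in_set uD; have pu := child_parent (dicr_neq_root HT uD).
  have := parent_N HT HM pu (dicrV uD); rewrite Ncal_root in_set1 => /eqP <-.
  exact: child_adj.
have [xA|xV] := boolP (x \in arrows T); last first.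
  rewrite -VA in xV; have [] := vertexP HM xV; last by move/dP; constructor 2.
  by rewrite Ncal_root in_set1 => /eqP; constructor 1.
constructor 3; have [x0|x1] := arrowsP xA; last first.
  by have [u uD xu] := mc1_arrow HM x1; exists u; rewrite dP // adjC.
have xr : x != v0 T by move: xA; rewrite !inE => /andP[].
have px := child_parent xr; have pV := child_V px.
exists (parent x); split=> //; last exact: child_adj.
have [|/dP//] := vertexP HM pV.
rewrite Ncal_root in_set1 => /eqP E; case: (root_no_bud x0).
by rewrite -E child_adj.
Qed.

Lemma root_sum : Nmul (v0 T) = \sum_(u in dicr_at (v0 T)) branch (v0 T) u.
Proof. by rewrite (Nmul_root HT HM) Nneighbors_root0 big_set0 add0r. Qed.

(** This is Delta(v_0) = 0. *)
Lemma root_defect :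
  \sum_(u in dicr_at (v0 T)) (Nmul (v0 T) - (degree u)%:Z) = 2 * (Nmul (v0 T) - 1).
Proof.
move: HD; rewrite Ncal_root big_set1 /DeltaZ e0 /Nquot (amul_root HT HM) divz1.
move: (\sum_(u in _) _) => s; lia.
Qed.

Lemma root_D0 : dicr_at (v0 T) != set0.
Proof.
apply/eqP => D0; have := Npos (root_N HT).
by rewrite root_sum D0 big_set0 ltxx.
Qed.

Lemma root_branch_ge u : u \in dicr_at (v0 T) -> (degree u)%:Z <= branch (v0 T) u.
Proof.
move=> uv; apply: branch_dicr_ge => //; first by case: (dicr_atP uv).
by apply: (dicr_at_child HT HM) => //; exact: root_N.
Qed.

(** The equality N_{v_0} = - det(e), with q(e, v_0) = 1. *)
Lemma root_edge u be : u \in dicr_at (v0 T) -> degree u = 1%N ->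
  be \in arrows0 T -> adj u be ->
  branch (v0 T) u = near u be /\ near u (v0 T) = near u be - Nmul (v0 T).
Proof.
move=> uv u1 b0 ub; have [uD vu] := dicr_atP uv; have vu' := child_v0 vu.
rewrite (branch_dicr HT HM uD vu' b0 ub) u1 mulr1; split=> //.
have := dicr_det HT HM uD vu'; rewrite u1 edge_detE (near_root HT vu) (Q_root HT).
rewrite (dicr_Q HT uD vu' b0 ub); lia.
Qed.

(** All degrees are 1 and N_{v_0} is the sum of the a_u, so there is a single
    dicritical vertex [u], with a_u = 1 and q(e, u) = a_u - N_{v_0} = 0. *)
Lemma elementary1_case : Nmul (v0 T) = 1 -> elementary1 T.
Proof.
move=> n1; have [u uv] := set0Pn _ root_D0.
have v0N := root_N HT.
have d1 t : t \in dicr_at (v0 T) -> degree t = 1%N.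
  by case/(degree_half HT HM v0N); rewrite n1; lia.
have DE t : t \in dicr_at (v0 T) -> t = u.
  move=> tv; apply/eqP/negPn/negP => tu; have := root_sum.
  rewrite n1 (bigD1 u) //= (bigD1 t) /= ?tv //.
  set B := (X in _ + (_ + X)); have B0 : 0 <= B.
    by apply: sumr_ge0 => i /andP[/andP[/root_branch_ge ge _] _]; apply: le_trans ge; lia.
  have := root_branch_ge uv; have := root_branch_ge tv; rewrite !d1 //; lia.
have [uD vu] := dicr_atP uv.
have [al [be [a1 b0 ua ub uall]]] := degree1 uD (d1 _ uv).
have pu : parent u = v0 T by apply: parent_child; exact: child_v0.
have [BE nu] := root_edge uv (d1 _ uv) b0 ub.
have ub1 : near u be = 1.
  rewrite -BE -n1 root_sum (big_pred1 u) // => t; apply/idP/eqP => [/DE//|->//].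
have aA := arrows1A a1; have bA := arrows0A b0.
have pa : parent al = u by apply: parent_child; exact: arrow_child.
have pb : parent be = u by apply: parent_child; exact: arrow_child.
have uV := dicrV uD.
have allc x : x \in [:: v0 T; u; al; be].
  rewrite !in_cons; case: (cell_root x) => [->|/DE->|[t [/DE-> ux xA]]]; rewrite ?eqxx ?orbT //.
  case: (uall _ ux) => [xE|->|->]; rewrite ?eqxx ?orbT //.
  by rewrite xE pu eqxx.
have Vneq x a : x \in vertices T -> a \in arrows T -> x != a.
  by rewrite VA => xV aA'; apply: contraNneq xV => ->.
have uq : uniq [:: v0 T; u; al; be].
  rewrite /= !in_cons !in_nil !orbF !negb_or (adj_neq vu).
  rewrite (Vneq _ _ (v0V T) aA) (Vneq _ _ (v0V T) bA) (Vneq _ _ uV aA) (Vneq _ _ uV bA) /=.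
  by rewrite andbT; apply: contraTneq a1 => ->; apply/negP => /arrows01; apply.
have edE e : e \in edges T -> [\/ e = [set v0 T; u], e = [set u; al] | e = [set u; be]].
  case/edgesP=> y yr ->; have := allc y; rewrite !in_cons (negbTE yr) in_nil orbF /=.
  by case/or3P=> /eqP->; rewrite ?pu ?pa ?pb; [constructor 1|constructor 2|constructor 3].
exists u, al, be; split=> //.
- apply/setP => e; rewrite !in_setU !in_set1; apply/idP/idP => [/edE[]->|].
  + by rewrite eqxx.
  + by rewrite eqxx orbT.
  + by rewrite eqxx !orbT.
  by case/orP=> [/orP[]|] /eqP->; [exact: vu|exact: ua|exact: ub].
- by split; [exact: deco1|exact: deco0].
- by rewrite setUC -/(near u (v0 T)) nu ub1 n1 subrr.
move=> e x /edE[]-> /set2P[]->; rewrite ?xpair_eqE ?eqxx // => _.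
- exact: (near_root HT).
- exact: near_arrow1 uD a1 b0 ua ub.
- by rewrite setUC; apply: near_arrow; rewrite // adjC.
- by rewrite setUC; apply: near_arrow; rewrite // adjC.
Qed.

(** The degrees add up to at most N_{v_0} by [root_sum].  Three dicritical
    vertices would give [root_defect] a left side of at least 2 N_{v_0}; for two
    of them, the equation reads d_u + d_t = 2. *)
Lemma two_dicriticals : 2 <= Nmul (v0 T) ->
  exists u t, [/\ u \in dicr_at (v0 T), t \in dicr_at (v0 T), u != t
   & (forall r, r \in dicr_at (v0 T) -> r = u \/ r = t) /\
     degree u = 1%N /\ degree t = 1%N].
Proof.
move=> n2; have v0N := root_N HT.
have [[u vu]|[u [t [uv tv ut _ _]]]] := type_cases HT HM Hgcd v0N root_D0.
  by have := root_defect; rewrite (defect_one_full vu); lia.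
exists u, t; have := root_defect; have := root_sum.
rewrite (bigD1 u) //= (bigD1 t) /=; last by rewrite tv eq_sym.
rewrite [in X in _ -> X](bigD1 u) //= [in X in _ -> X](bigD1 t) /=; last by rewrite tv eq_sym.
set B := \sum_(i | _) _ => BE; set D := \sum_(i | _) _ => DE.
have bu := root_branch_ge uv; have bt := root_branch_ge tv.
have [r /andP[/andP[rv ru] rt]|none] := pickP [pred r | (r \in dicr_at (v0 T)) && (r != u) && (r != t)].
  have rP : (r \in dicr_at (v0 T)) && (r != u) && (r != t) by rewrite rv ru rt.
  have B1 : (degree r)%:Z <= B.
    rewrite /B (bigD1 r) //=; have := root_branch_ge rv.
    set C := (X in _ + X); have C0 : 0 <= C; last by lia.
    by apply: sumr_ge0 => i /andP[/andP[/andP[/root_branch_ge ge _] _] _]; apply: le_trans ge; lia.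
  have D1 : Nmul (v0 T) - (degree r)%:Z <= D.
    rewrite /D (bigD1 r) //= lerDl; apply: sumr_ge0 => i.
    by case/andP=> /andP[/andP[/(degree_half HT HM v0N)[_ ? _] _] _] _; lia.
  lia.
have rE r : r \in dicr_at (v0 T) -> r = u \/ r = t.
  move=> rv; have := none r; rewrite /= rv /=.
  by case: eqP => [|_ /=]; [left|case: eqP => //; right].
have B0 : B = 0 by rewrite /B big_pred0.
have D0 : D = 0 by rewrite /D big_pred0.
have [u1 _ _] := degree_half HT HM v0N uv; have [t1 _ _] := degree_half HT HM v0N tv.
by split=> //; split=> //; lia.
Qed.

(** Now N_{v_0} = a_1 + a_2, so the decoration a_i - N_{v_0} near u_i is minus
    the other a_j, and coprimality at u_1 gives gcd (a_1, a_2) = 1. *)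
Lemma elementary2_case : 2 <= Nmul (v0 T) -> elementary2 T.
Proof.
move=> n2; have v0N := root_N HT.
have [u1 [u2 [uv1 uv2 u12 [uall [d1 d2]]]]] := two_dicriticals n2.
have [uD1 vu1] := dicr_atP uv1; have [uD2 vu2] := dicr_atP uv2.
have [al1 [be1 [a1 b1 ua1 ub1 all1]]] := degree1 uD1 d1.
have [al2 [be2 [a2 b2 ua2 ub2 all2]]] := degree1 uD2 d2.
have [B1 n1] := root_edge uv1 d1 b1 ub1; have [B2 n2'] := root_edge uv2 d2 b2 ub2.
have NE : Nmul (v0 T) = near u1 be1 + near u2 be2.
  rewrite root_sum (bigD1 u1) //= B1 (bigD1 u2) /= ?uv2 1?eq_sym // B2.
  rewrite big_pred0 ?addr0 // => r; apply/negP => /andP[/andP[/uall[]->]]; by rewrite eqxx.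
have uV1 := dicrV uD1; have uV2 := dicrV uD2.
have aA1 := arrows1A a1; have bA1 := arrows0A b1.
have aA2 := arrows1A a2; have bA2 := arrows0A b2.
have p1 := near_ge1 HT uV1 (arrow_child bA1 ub1).
have p2 := near_ge1 HT uV2 (arrow_child bA2 ub2).
have pu1 : parent u1 = v0 T by apply: parent_child; exact: child_v0.
have pu2 : parent u2 = v0 T by apply: parent_child; exact: child_v0.
have pa1 : parent al1 = u1 by apply: parent_child; exact: arrow_child.
have pb1 : parent be1 = u1 by apply: parent_child; exact: arrow_child.
have pa2 : parent al2 = u2 by apply: parent_child; exact: arrow_child.
have pb2 : parent be2 = u2 by apply: parent_child; exact: arrow_child.
have [k1 k1E] : exists k : nat, near u1 be1 = k%:Z.
  by exists `|near u1 be1|%N; rewrite gez0_abs // (le_trans _ p1).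
have [k2 k2E] : exists k : nat, near u2 be2 = k%:Z.
  by exists `|near u2 be2|%N; rewrite gez0_abs // (le_trans _ p2).
rewrite k1E k2E in NE n1 n2' p1 p2.
have cop : gcdn k1 k2 = 1%N.
  have vb : v0 T != be1 by apply: contraTneq bA1 => <-; rewrite -in_setC -/(vertices T) v0V.
  have := near_coprime HT uV1 (etrans (adjC u1 (v0 T)) vu1) ub1 vb.
  rewrite n1 k1E NE /coprimez /gcdz !(opprD, opprK) addrA subrr add0r abszN /=.
  by rewrite gcdnC => /eqP[].
have allc x : x \in [:: v0 T; u1; u2; al1; al2; be1; be2].
  rewrite !in_cons; case: (cell_root x) => [->|/uall[]->|[t [/uall[]-> ux xA]]];
    rewrite ?eqxx ?orbT //.
    by case: (all1 _ ux) => [xE|->|->]; rewrite ?eqxx ?orbT // xE pu1 eqxx.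
  by case: (all2 _ ux) => [xE|->|->]; rewrite ?eqxx ?orbT // xE pu2 eqxx.
have Vneq x a : x \in vertices T -> a \in arrows T -> x != a.
  by rewrite VA => xV aA'; apply: contraNneq xV => ->.
have neq01 a b : a \in arrows1 T -> b \in arrows0 T -> a != b.
  by move=> a1' b0; apply: contraTneq a1' => ->; apply/negP => /arrows01; apply.
have pneq x y : parent x = u1 -> parent y = u2 -> x != y.
  by move=> xE yE; apply: contraNneq u12 => xy; rewrite -xE xy yE.
have uq : uniq [:: v0 T; u1; u2; al1; al2; be1; be2].
  rewrite /= !in_cons !in_nil !orbF !negb_or (adj_neq vu1) (adj_neq vu2) u12.
  rewrite (Vneq _ _ (v0V T) aA1) (Vneq _ _ (v0V T) aA2) (Vneq _ _ (v0V T) bA1).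
  rewrite (Vneq _ _ (v0V T) bA2) (Vneq _ _ uV1 aA1) (Vneq _ _ uV1 aA2) (Vneq _ _ uV1 bA1).
  rewrite (Vneq _ _ uV1 bA2) (Vneq _ _ uV2 aA1) (Vneq _ _ uV2 aA2) (Vneq _ _ uV2 bA1).
  rewrite (Vneq _ _ uV2 bA2) (pneq _ _ pa1 pa2) (pneq _ _ pb1 pb2).
  by rewrite (neq01 _ _ a1 b1) (neq01 _ _ a1 b2) (neq01 _ _ a2 b1) (neq01 _ _ a2 b2).
have edE e : e \in edges T -> e \in [:: [set v0 T; u1]; [set v0 T; u2];
     [set u1; al1]; [set u1; be1]; [set u2; al2]; [set u2; be2]].
  case/edgesP=> y yr ->; have := allc y; rewrite !in_cons (negbTE yr) in_nil orbF /=.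
  by do ?case/orP; move/eqP->; rewrite ?pu1 ?pa1 ?pb1 ?pu2 ?pa2 ?pb2 eqxx ?orbT.
exists k1, k2, u1, u2, al1, al2, be1, be2; split.
- by split.
- by [].
- apply/setP => e; rewrite [in RHS]in_set; apply/idP/idP => [/edE//|].
  rewrite !in_cons in_nil orbF; do ?case/orP; move/eqP=> ->; assumption.
- by split; [exact: deco1|exact: deco1|exact: deco0|exact: deco0].
split=> //.
- by rewrite setUC -/(near u1 (v0 T)) n1 NE opprD addrA subrr add0r.
- by rewrite setUC -/(near u2 (v0 T)) n2' NE opprD addrCA subrr addr0.
move=> e x /edE; rewrite !in_cons in_nil orbF.
do ?case/orP; move/eqP=> -> /set2P[]->; rewrite ?xpair_eqE ?eqxx ?orbT //= => _.
- exact: (near_root HT).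
- exact: (near_root HT).
- exact: near_arrow1 uD1 a1 b1 ua1 ub1.
- by rewrite setUC; apply: near_arrow; rewrite // adjC.
- by rewrite setUC; apply: near_arrow; rewrite // adjC.
- exact: near_arrow1 uD2 a2 b2 ua2 ub2.
- by rewrite setUC; apply: near_arrow; rewrite // adjC.
- by rewrite setUC; apply: near_arrow; rewrite // adjC.
Qed.

Lemma elementary_case : elementary1 T \/ elementary2 T.
Proof.
have [n1|n2] : Nmul (v0 T) = 1 \/ 2 <= Nmul (v0 T) by have := Npos (root_N HT); lia.
  by left; exact: elementary1_case.
by right; exact: elementary2_case.
Qed.

End Elementary.

(** * A root of valency different from 1 *)

Section TwoLeaves.
Variable T : drtree.
Implicit Types (x y z u v w a b c p : cell T) (e : {set cell T}).
Hypothesis HT : abstract_newton_tree T.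
Hypothesis HM : minimally_complete T.
Hypothesis Hgcd : nodes T = nodes_star T.
Hypothesis HD : \sum_(v in Ncal T) DeltaZ v = 0.

Lemma buds_root : buds (v0 T) = set0.
Proof.
apply/setP => b; rewrite in_set0; apply/negP; rewrite in_set => /andP[b0 vb].
exact: (root_no_bud HT HM b0 vb).
Qed.

Lemma valency_root : valency (v0 T) = (eps (v0 T) + #|dicr_at (v0 T)|)%N.
Proof. by rewrite (valency_N HM (root_N HT)) buds_root cards0 addn0. Qed.

Lemma Nquot_root : Nquot (v0 T) = Nmul (v0 T).
Proof. by rewrite /Nquot (amul_root HT HM) divz1. Qed.

Lemma root_child_N c : c \in Nneighbors (v0 T) -> c \in Ncal T /\ child (v0 T) c.
Proof. by case/NneighborsP=> cN vc; rewrite child_v0. Qed.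

Lemma nodesE v : (v \in nodes T) = (v \in Ncal T) && (dicr_at v != set0).
Proof. by rewrite [v \in nodes T]in_set. Qed.

Hypothesis e1 : (0 < eps (v0 T))%N.

Lemma Nroot_ge2 : 2 <= Nmul (v0 T).
Proof.
have [c /root_child_N[cN vc]] := card_gt0P e1.
exact: (Nmul_ge2 HT HM cN vc).
Qed.

Hypothesis val1 : valency (v0 T) <> 1%N.

(** With valency different from 1, a root with eps = 1 is a node, and
    [leaf_DeltaZ] applies to it. *)
Lemma root_DeltaZ_ge0 : 0 <= DeltaZ (v0 T).
Proof.
have v0N := root_N HT.
have [e2|e2] := leqP 2 (eps (v0 T)).
  have := defect_ge0 HT HM v0N; have := Nroot_ge2.
  rewrite /DeltaZ Nquot_root subrr addr0; move: (\sum_(u in _) _) => s n2 s0.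
  by apply: addr_ge0 => //; apply: mulr_ge0; lia.
have e1' : eps (v0 T) = 1%N by apply/eqP; rewrite eqn_leq e1 -ltnS e2.
have [] // := leaf_DeltaZ HT HM Hgcd v0N e1'.
apply/eqP => D0; apply: val1; by rewrite valency_root e1' D0 cards0.
Qed.

(** The terms are nonnegative and add up to 0. *)
Lemma all_DeltaZ0 v : v \in Ncal T -> DeltaZ v = 0.
Proof.
move=> vN; apply/eqP; move/eqP: HD; rewrite psumr_eq0 => [/allP/(_ v)|x xN].
  by rewrite mem_index_enum vN; apply.
have [->|xr] := eqVneq x (v0 T); first exact: root_DeltaZ_ge0.
exact: (nonroot_DeltaZ HT HM Hgcd).
Qed.

Lemma nonroot_light v : v \in Ncal T -> v != v0 T -> v \in light_leaves T.
Proof.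
by move=> vN vr; apply: (nonroot_DeltaZ0 HT HM Hgcd) => //; rewrite all_DeltaZ0.
Qed.

(** The parent of [v], were it not the root, would be a leaf of N having [v] as a
    child. *)
Lemma nonroot_nbr v : v \in Ncal T -> v != v0 T -> v \in Nneighbors (v0 T).
Proof.
move=> vN vr; have pv := child_parent vr; have pN := parent_N HT HM pv (NV vN).
rewrite in_set vN /=; have [<-|pr] := eqVneq (parent v) (v0 T); first exact: child_adj.
have /light_leavesP[_ _ ep _] := nonroot_light pN pr.
have := leaf_desc HT HM pN pr ep vN; rewrite (child_gam pv) in_cons mem_gam_l orbT.
by move=> /(_ isT) E; have := child_neq pv; rewrite -E eqxx.
Qed.

Lemma Ncal_star : Ncal T = v0 T |: Nneighbors (v0 T).
Proof.
apply/setP => x; rewrite in_setU1; apply/idP/orP => [xN|[/eqP->|/NneighborsP[]//]].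
  by have [->|xr] := eqVneq x (v0 T); [left|right; exact: nonroot_nbr].
exact: root_N.
Qed.

Lemma Wset_empty : Wset T = set0.
Proof.
apply/setP => w; rewrite in_set0; apply/negP; rewrite in_set => /existsP[v].
case/(Gamma_gam HT HM Hgcd)=> vN _ _ wv; rewrite all_DeltaZ0 ?ltxx //.
exact: (parent_N HT HM wv (NV vN)).
Qed.

Lemma Omega_leaves v : (v \in Omega T) = (v \in Ncal T) && (eps v == 1%N).
Proof.
rewrite /Omega Wset_empty big_set0 setD0 [v \in Zset T]in_set.
case vN: (v \in Ncal T) => //=.
by rewrite (DeltaE HT HM) // all_DeltaZ0 // lexx andbT.
Qed.

Lemma root_nbr_light c : c \in Nneighbors (v0 T) ->
  [/\ c \in Ncal T, c != v0 T, eps c = 1%N, amul c = 1 & child (v0 T) c].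
Proof.
case/root_child_N=> cN vc.
have cr : c != v0 T by rewrite eq_sym; exact: child_neq.
have cL := nonroot_light cN cr; have [_ _ ec _] := light_leavesP _ cL.
by have [_ a1 _] := light_leaf_one_full HT HM Hgcd cL.
Qed.

(** Since a_c = 1 there is no dead end at [c], so its valency requires at least
    two dicritical neighbours. *)
Lemma root_nbr_type c : c \in Nneighbors (v0 T) ->
  [/\ c \in nodes T, type_1N c & size (node_type c) <> 1%N].
Proof.
move=> cv; have [cN cr ec a1 vc] := root_nbr_light cv.
have cL := nonroot_light cN cr.
have [_ _ [u cu]] := light_leaf_one_full HT HM Hgcd cL.
have := valency_ge3 HT HM cN cr; rewrite ec a1 eqxx addn0 add1n ltnS => D2.
split; first by rewrite nodesE cN -card_gt0; exact: ltnW.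
  exact: one_full_type cu.
by rewrite /node_type size_sort size_map -cardE => D1; rewrite D1 in D2.
Qed.

(** An entry N_{v_0} in the type would alone exhaust N_{v_0}, which also receives
    the contributions of the other branches at the root. *)
Lemma root_node_type : eps (v0 T) = 1%N ->
  [/\ v0 T \in nodes T, type_1N (v0 T) & size (node_type (v0 T)) = 1%N].
Proof.
move=> e1'; have v0N := root_N HT.
have D0 : dicr_at (v0 T) != set0.
  by apply/eqP => D0; apply: val1; rewrite valency_root e1' D0 cards0.
have [_ []] := leaf_DeltaZ HT HM Hgcd v0N e1' D0; first by rewrite all_DeltaZ0.
move=> _ _ [u vu]; split; first by rewrite nodesE v0N.
  exact: one_full_type vu.
have [uv u1 full] := vu.
rewrite /node_type size_sort size_map -cardE (cardsD1 u) uv.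
suff -> : dicr_at (v0 T) :\ u = set0 by rewrite cards0.
apply/setP => t; rewrite in_set0; apply/negP; rewrite in_setD1 => /andP[tu tv].
have [c cv] := card_gt0P e1; have [cN vc] := root_child_N cv.
have := Nmul_root HT HM; rewrite (bigD1 c) //= [X in _ + _ + X](bigD1 t) //=.
have bc := branch_ge1 HT vc (V_arrows0 (NV cN)).
have bt := branch_dicr_ge HT HM (dicr_atP tv).1 (child_v0 (dicr_atP tv).2).
set B := (X in _ + X + _); set D := (X in _ + (_ + X)) => E.
have B0 : 0 <= B.
  apply: sumr_ge0 => x /andP[/root_child_N[_ vx] _]; exact: (branch_ge0 HT).
have D0' : 0 <= D.
  apply: sumr_ge0 => x /andP[/dicr_atP[_ /child_v0 vx] _]; exact: (branch_ge0 HT).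
by have := full t tv tu; lia.
Qed.

(** Otherwise (eps - 2)(N_{v_0} - 1) > 0, whereas Delta(v_0) = 0. *)
Lemma eps_root_le2 : (eps (v0 T) <= 2)%N.
Proof.
have v0N := root_N HT; rewrite leqNgt; apply/negP => e3.
have := all_DeltaZ0 v0N; have := defect_ge0 HT HM v0N; have := Nroot_ge2.
rewrite /DeltaZ Nquot_root subrr addr0; move: (\sum_(u in _) _) => s n2 s0.
have : 1 * 1 <= ((eps (v0 T))%:Z - 2) * (Nmul (v0 T) - 1) by apply: ler_pM; lia.
lia.
Qed.

Lemma root_no_dicr : eps (v0 T) = 2%N -> dicr_at (v0 T) = set0.
Proof.
move=> e2; apply/eqP/negPn/negP => D0; have v0N := root_N HT.
have := all_DeltaZ0 v0N; rewrite /DeltaZ e2 Nquot_root !subrr mul0r !add0r.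
have := Nroot_ge2; have [[u vu]|] := defect_node HT HM Hgcd v0N D0.
  by rewrite (defect_one_full vu); lia.
by move: (\sum_(u in _) _) => s; lia.
Qed.

Lemma two_leaves_case : #|Omega T| = 2%N /\
  exists z : seq (cell T),
    [/\ trivial_path z /\ Ncal T = [set x in z],
        size z = 2%N \/ size z = 3%N,
        size z = 3%N -> v0 T = nth (v0 T) z 1,
        forall x, x \in z -> amul x = 1
      & nodes T = [set head (v0 T) z; last (v0 T) z] /\
        forall v, v \in nodes T ->
          type_1N v /\ (size (node_type v) = 1%N <-> v = v0 T)].
Proof.
have v0N := root_N HT.
have adjs c : c \in Nneighbors (v0 T) -> adj c (v0 T) /\ adj (v0 T) c.
  by case/NneighborsP=> _ vc; rewrite adjC.
have ndE v : v \in Ncal T -> v \in nodes T = (v == v0 T) ==> (eps v == 1%N).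
  move=> vN; have [->|vr] /= := eqVneq v (v0 T).
    have := eps_root_le2; rewrite leq_eqVlt => /orP[/eqP e2|e2].
      by rewrite nodesE root_no_dicr // eqxx andbF e2.
    have e1' : eps (v0 T) = 1%N by apply/eqP; rewrite eqn_leq e1 -ltnS e2.
    by have [-> _ _] := root_node_type e1'; rewrite e1'.
  by have [-> _ _] := root_nbr_type (nonroot_nbr vN vr).
have tyE v : v \in nodes T -> type_1N v /\ (size (node_type v) = 1%N <-> v = v0 T).
  move=> vn; have vN : v \in Ncal T by move: vn; rewrite nodesE => /andP[].
  move: (vn); rewrite (ndE _ vN); have [->|vr] /= := eqVneq v (v0 T).
    by move/eqP/root_node_type=> [_ ? ?].
  have [_ ty sz] := root_nbr_type (nonroot_nbr vN vr); split=> //; split=> // E.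
  by rewrite E eqxx in vr.
have am x : x \in Ncal T -> amul x = 1.
  have [->|xr] := eqVneq x (v0 T); first by rewrite (amul_root HT HM).
  by move=> /nonroot_nbr/(_ xr)/root_nbr_light[].
have := eps_root_le2; rewrite leq_eqVlt => /orP[/eqP e2|e2].
  have /cards2P[c1 [c2 [c12 nE]]] : #|Nneighbors (v0 T)| == 2%N by apply/eqP.
  have c1v : c1 \in Nneighbors (v0 T) by rewrite nE set21.
  have c2v : c2 \in Nneighbors (v0 T) by rewrite nE set22.
  have [c1N c1r ec1 _ _] := root_nbr_light c1v.
  have [c2N c2r ec2 _ _] := root_nbr_light c2v.
  have NE : Ncal T = [set x in [:: c1; v0 T; c2]].
    by rewrite Ncal_star nE; apply/setP => x; rewrite !inE; do !case: eqP.
  have NP x : x \in Ncal T -> [\/ x = c1, x = v0 T | x = c2].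
    rewrite NE inE !in_cons in_nil orbF => /or3P[]/eqP->; by [constructor 1|constructor 2|constructor 3].
  split.
    suff -> : Omega T = [set c1; c2] by rewrite cards2 c12.
    apply/setP => x; rewrite Omega_leaves in_set2; apply/andP/orP => [[/NP[]->]|[]/eqP->].
    - by left.
    - by rewrite e2.
    - by right.
    - by rewrite c1N ec1.
    - by rewrite c2N ec2.
  exists [:: c1; v0 T; c2]; split=> //.
  - split=> //; apply/and5P; split=> //=.
    + rewrite /is_path /= (adjs _ c1v).1 (adjs _ c2v).2 /= !in_cons !in_nil !orbF.
      by rewrite (negbTE c1r) c12 eq_sym c2r.
    + by rewrite c1N v0N c2N.
    + by rewrite ec1.
    + by apply/forallP => -[[|[|[]]]] //= _; rewrite e2 (DeltaE HT HM) // all_DeltaZ0 // eqxx.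
  - by right.
  - by move=> x xz; apply: am; rewrite NE inE.
  split=> //=; apply/setP => x; rewrite in_set2; apply/idP/orP => [xn|[]/eqP->].
  - have xN : x \in Ncal T by move: xn; rewrite nodesE => /andP[].
    move: xn; rewrite ndE //; case: (NP _ xN) => ->; rewrite ?eqxx ?e2; by [left|right].
  - by rewrite ndE // ec1 implybT.
  - by rewrite ndE // ec2 implybT.
have e1' : eps (v0 T) = 1%N by apply/eqP; rewrite eqn_leq e1 -ltnS e2.
have /cards1P[c nE] : #|Nneighbors (v0 T)| == 1%N by apply/eqP.
have cv : c \in Nneighbors (v0 T) by rewrite nE set11.
have [cN cr ec _ _] := root_nbr_light cv.
have NE : Ncal T = [set x in [:: v0 T; c]].
  by rewrite Ncal_star nE; apply/setP => x; rewrite !inE.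
have NP x : x \in Ncal T -> x = v0 T \/ x = c.
  by rewrite NE inE !in_cons in_nil orbF => /orP[]/eqP->; [left|right].
have OE : forall x, x \in Ncal T -> eps x = 1%N by move=> x /NP[]->.
split.
  suff -> : Omega T = [set v0 T; c] by rewrite cards2 eq_sym cr.
  apply/setP => x; rewrite Omega_leaves in_set2; apply/andP/orP => [[/NP[]->]|[]/eqP->].
  - by left.
  - by right.
  - by rewrite v0N e1'.
  - by rewrite cN ec.
exists [:: v0 T; c]; split=> //.
- split=> //; apply/and5P; split=> //=.
  + by rewrite /is_path /= (adjs _ cv).2 mem_seq1 eq_sym cr.
  + by rewrite v0N cN.
  + by rewrite e1'.
  + by apply/forallP => -[[|[]]].
- by left.
- by move=> x xz; apply: am; rewrite NE inE.
split=> //=; apply/setP => x; rewrite in_set2; apply/idP/orP => [xn|[]/eqP->].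
- by move: xn; rewrite nodesE => /andP[/NP[]-> _]; rewrite eqxx; [left|right].
- by rewrite ndE // e1' implybT.
- by rewrite ndE // ec implybT.
Qed.

End TwoLeaves.

(** * A root of valency 1 *)

Section OneLeaf.
Variable T : drtree.
Implicit Types (x y u v w a b c p t : cell T) (e : {set cell T}) (z : seq (cell T)).
Hypothesis HT : abstract_newton_tree T.
Hypothesis HM : minimally_complete T.
Hypothesis Hgcd : nodes T = nodes_star T.
Hypothesis HD : \sum_(v in Ncal T) DeltaZ v = 0.
Hypothesis e1 : (0 < eps (v0 T))%N.
Hypothesis val1 : valency (v0 T) = 1%N.

Lemma root_e1 : eps (v0 T) = 1%N /\ dicr_at (v0 T) = set0.
Proof.
have := val1; rewrite (valency_root HT HM) => E.
split; first by move: e1 E; case: (eps _) => [//|[|k]] //=.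
by apply/eqP; rewrite -cards_eq0; move: e1 E; case: (eps _) => [//|k] _ [] /eqP; rewrite addn_eq0 => /andP[].
Qed.

Lemma root_DeltaZ : DeltaZ (v0 T) = 1 - Nmul (v0 T).
Proof.
have [e1' D0] := root_e1.
rewrite /DeltaZ e1' D0 big_set0 (Nquot_root HT HM); lia.
Qed.

Lemma descend x c : child x c -> forall v, c \in gam v (v0 T) -> x \in gam v (v0 T).
Proof.
move=> xc v; elim/rooted_ind: v => [|y v yv IH].
  by rewrite gamxx mem_seq1 => /eqP cE; rewrite cE child_root in xc.
rewrite (child_gam yv) !in_cons => /orP[/eqP cv|/IH->]; last by rewrite orbT.
by rewrite cv in xc; rewrite (child_inj xc yv) mem_gam_l orbT.
Qed.

Lemma root_only v : v \in Ncal T -> child (v0 T) v ->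
  forall x, x \in Ncal T -> x = v0 T \/ v \in gam x (v0 T).
Proof.
move=> vN rv x xN; have [->|xr] := eqVneq x (v0 T); [by left|right].
have [c rc cx] := gam_child (v0_gam x) xr.
have cN := ancestor_N HT HM xN cx; have [e1' _] := root_e1.
have /cards1P[y yE] : #|Nneighbors (v0 T)| == 1%N by apply/eqP.
have cy : c \in [set y] by rewrite -yE in_set cN child_adj.
have vy : v \in [set y] by rewrite -yE in_set vN child_adj.
by move: cy vy cx; rewrite !in_set1 => /eqP-> /eqP->.
Qed.

(** If the parent of [v] were the root, N would be {v_0, v} and the total of
    Delta would be 1 - N_{v_0} < 0. *)
Lemma light_parent_pos v : v \in light_leaves T -> 0 < DeltaZ (parent v).
Proof.
move=> vL; have [vN vr ev _] := light_leavesP _ vL.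
have pv := child_parent vr; have pN := parent_N HT HM pv (NV vN).
have [pr|pr] := eqVneq (parent v) (v0 T).
  have [d0 _ _] := light_leaf_one_full HT HM Hgcd vL.
  rewrite pr in pv; have NE : Ncal T = v0 T |: [set v].
    apply/setP => x; rewrite in_setU1 in_set1; apply/idP/orP => [xN|[]/eqP->//]; last exact: root_N.
    have [->|/(leaf_desc HT HM vN vr ev xN)->] := root_only vN pv xN; first by left.
    by right.
  have rv : v0 T \notin [set v] by rewrite in_set1 eq_sym.
  move: HD; rewrite NE (big_setU1 _ rv) big_set1 /= d0 addr0 root_DeltaZ.
  have := Nroot_ge2 HT HM e1; lia.
apply: (inner_DeltaZ HT HM Hgcd) => //.
have gN := parent_N HT HM (child_parent pr) (NV pN).
apply/card_gt1P; exists v, (parent (parent v)); split.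
- by rewrite in_set vN (child_adj pv).
- by rewrite in_set gN (child_adjC (child_parent pr)).
apply/eqP => vE; have := child_parent pr; rewrite -vE => vp.
by move: (vp); rewrite (childE (child_adj vp)) pv.
Qed.

Lemma Omega_one : Omega T = [set v0 T].
Proof.
have [e1' _] := root_e1.
have vZ : v0 T \in Zset T.
  rewrite in_set (root_N HT) e1' (DeltaE HT HM (root_N HT)) lerz0 root_DeltaZ.
  by have := Nroot_ge2 HT HM e1; lia.
rewrite /Omega (bigcup_Vset HT HM Hgcd light_parent_pos) (ZsetE HT HM vZ).
apply/setP => x; rewrite in_setD in_setU1 in_set1.
have [xL|] := boolP (x \in light_leaves T); last by rewrite orbF.
by have [_ /negbTE-> _ _] := light_leavesP _ xL.
Qed.

(** [z] is an initial segment v_0, ..., z_k of N without dicritical neighbours,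
    and every other vertex of N is [c] or lies beyond it.  By [chain_sum] the sum
    of Delta over [z] exceeds 1 - M by X, where M is the branch of z_k through
    [c].  The alternative X = 0 or X >= M records that the excess cannot be small:
    it is a sum of terms divisible by the branches further down. *)
Record chain z c : Prop := Chain {
  chain_path : is_path z;
  chain_head : head (v0 T) z = v0 T;
  chain_N : {subset z <= Ncal T};
  chain_cN : c \in Ncal T;
  chain_last : child (last (v0 T) z) c;
  chain_cover : forall x, x \in Ncal T -> x \in z \/ c \in gam x (v0 T);
  chain_above : forall x, x \in z -> c \notin gam x (v0 T);
  chain_dicr : forall x, x \in z -> dicr_at x = set0;
  chain_pos : forall x, x \in z -> x != v0 T -> 0 < DeltaZ x;
  chain_back : branch c (last (v0 T) z) = 0;
  chain_sum : exists X, \sum_(x <- z) DeltaZ x = 1 - branch (last (v0 T) z) c + X /\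
    (X = 0 \/ branch (last (v0 T) z) c <= X)
}.

Lemma chain0 : exists c, chain [:: v0 T] c.
Proof.
have [e1' D0] := root_e1; have /cards1P[c cE] : #|Nneighbors (v0 T)| == 1%N by apply/eqP.
have [cN rc] : c \in Ncal T /\ child (v0 T) c by apply: root_child_N; rewrite cE set11.
have cr : c != v0 T by rewrite eq_sym child_neq.
exists c; split=> //=.
- by move=> x; rewrite mem_seq1 => /eqP->; exact: root_N.
- by move=> x /(root_only cN rc)[->|]; [left; rewrite mem_seq1|right].
- by move=> x; rewrite mem_seq1 => /eqP->; rewrite gamxx mem_seq1.
- by move=> x; rewrite mem_seq1 => /eqP->.
- by move=> x; rewrite mem_seq1 => ->.
- rewrite (branch_N HM (root_N HT)) ?child_adjC // D0 cE.
  rewrite [X in _ + X]big_pred0 => [|x]; last by rewrite in_set0.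
  by rewrite big_pred0 ?addr0 // => x; rewrite in_set1; case: eqP.
exists 0; rewrite big_seq1 root_DeltaZ addr0 (Nmul_root HT HM) D0 cE big_set0 addr0 big_set1.
by split; [|left].
Qed.

Lemma chain_nonnil z c : chain z c -> v0 T \in z /\ uniq z.
Proof.
case=> + + _ _ _ _ _ _ _ _ _; case: z => [//|x z] /= /andP[_ uz] /= xE.
by split; rewrite // xE mem_head.
Qed.

Lemma chain_c z c : chain z c -> c \notin z.
Proof.
by move=> C; apply/negP => /(chain_above C); rewrite mem_gam_l.
Qed.

Lemma chain_cr z c : chain z c -> c != v0 T.
Proof. by move=> /chain_last; apply: contraTneq => ->; rewrite child_root. Qed.

Lemma chain_pz z c : chain z c -> last (v0 T) z \in z.
Proof.
by move=> C; have := chain_path C; case: (z) => [//|x s] _; rewrite /= mem_last.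
Qed.

(** No arrow lies behind [c], so N_c is a multiple of the branch through [c]. *)
Lemma chain_mul z c : chain z c ->
  [/\ Nmul c = near c (last (v0 T) z) * branch (last (v0 T) z) c,
      1 <= near c (last (v0 T) z) & 1 <= branch (last (v0 T) z) c].
Proof.
move=> C; have cN := chain_cN C; have pc := chain_last C.
have NE := Nmul_edge (child_adjC pc) (V_arrows1 (NV cN)).
rewrite (chain_back C) mulr0 add0r in NE.
have b1 := branch_ge1 HT pc (V_arrows0 (NV cN)); have n0 := Npos cN.
split=> //; move: NE n0 b1; move: (near _ _) (branch _ _) (Nmul c) => q B n ->; nia.
Qed.

Lemma chain_child z c x : chain z c -> x \in Ncal T -> x \notin z -> x != c ->
  exists2 y, y \in Nneighbors c :\ last (v0 T) z & y \in gam x (v0 T).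
Proof.
move=> C xN xz xc; have [|cx] := chain_cover C xN; first by rewrite (negbTE xz).
have [y cy yx] := gam_child cx xc; exists y => //.
have yN := ancestor_N HT HM xN yx.
rewrite in_setD1 [y \in Nneighbors c]in_set yN (child_adj cy) /= andbT.
by apply: contraTneq cy => ->; rewrite childE ?(chain_last C) // (child_adjC (chain_last C)).
Qed.

Lemma chain_extend z c : chain z c ->
  [/\ is_path (rcons z c), {subset rcons z c <= Ncal T}, (1 < size (rcons z c))%N,
      head (v0 T) (rcons z c) = v0 T & last (v0 T) (rcons z c) = c].
Proof.
move=> C; have cN := chain_cN C; split.
- have := chain_path C; have := chain_c C; have := chain_last C.
  case: (z) => [//|x s] /= pc' cs /andP[ps us].
  move: us cs; rewrite /is_path /= rcons_path ps (child_adj pc') /= !rcons_uniq in_cons negb_or.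
  by rewrite mem_rcons in_cons negb_or eq_sym => /andP[-> ->] /andP[-> ->].
- by move=> x; rewrite mem_rcons in_cons => /orP[/eqP->//|/(chain_N C)].
- by have := chain_path C; case: (z) => [//|x s] _; rewrite /= size_rcons.
- by have := chain_head C; have := chain_path C; case: (z).
by rewrite last_rcons.
Qed.

(** With m = a_c, q the decoration near [c] towards the root and B the branch of
    [c] through [c'], the branch through [c] is m B, N_c = q m B and
    Delta(c) = q m B - q B.  The bound 1 - m B + X becomes 1 - B + X', where
    X' = X + (q - 1)(m - 1) B. *)
Lemma chain_step z c : chain z c -> eps c = 2%N -> dicr_at c = set0 ->
  exists c', chain (rcons z c) c'.
Proof.
move=> C e2 D0; have cN := chain_cN C; have cV := NV cN; have pc := chain_last C.
set p := last (v0 T) z in pc.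
have pN : p \in Ncal T by apply: (chain_N C); exact: chain_pz C.
have pnb : p \in Nneighbors c by rewrite in_set pN (child_adjC pc).
have /cards1P[c' cE] : #|Nneighbors c :\ p| == 1%N.
  have := e2; rewrite /eps -/(Nneighbors c) (cardsD1 p) pnb add1n => -[->]; exact: eqxx.
have nbE : Nneighbors c = [set p; c'] by rewrite -(setD1K pnb) cE.
have : c' \in Nneighbors c :\ p by rewrite cE set11.
rewrite in_setD1 => /andP[c'p c'nb]; have [c'N cc'] := NneighborsP c'nb.
have {}cc' := child_of_adj pc cc' c'p.
(* without a dead end, c would have valency 2 *)
have a1 : amul c <> 1.
  move=> a1; have := valency_ge3 HT HM cN (chain_cr C).
  by rewrite e2 D0 cards0 a1.
have [[_ /a1//]|[b [bE b0 cb aE a2]]] := buds_N HT HM cN.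
have Q2E : Q2 c p c' = amul c.
  rewrite aE /Q2 (big_pred1 b) // => x /=; apply/and3P/eqP => [[cx xp xc']|->].
    case: (N_adj HM cN cx) => [xN|xD|x0].
    - have : x \in Nneighbors c by rewrite in_set xN.
      by rewrite nbE in_set2 (negbTE xp) (negbTE xc').
    - have : x \in dicr_at c by rewrite in_set xD.
      by rewrite D0 in_set0.
    by apply/eqP; rewrite -in_set1 -bE in_set x0.
  split=> //; apply: contraTneq b0 => ->; apply: V_arrows0; exact: NV.
have BE : branch p c = amul c * branch c c'.
  rewrite (branch_N HM cN (child_adj pc)) D0 nbE [X in _ + X]big_pred0 => [|x]; last by rewrite in_set0.
  rewrite addr0 (big_pred1 c') ?Q2E // => x; rewrite in_set2.
  by have [->|xp] := eqVneq x p; rewrite ?andbT //= ?andbF; apply/esym/negbTE; rewrite eq_sym.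
have back : branch c' c = 0.
  rewrite (branch_N HM cN (child_adjC cc')) D0 nbE [X in _ + X]big_pred0 => [|x]; last by rewrite in_set0.
  rewrite addr0 (big_pred1 p) => [|x].
    by rewrite (chain_back C) mulr0.
  rewrite in_set2; have [->|xc'] /= := eqVneq x c'; last by rewrite orbF andbT.
  by rewrite andbF; apply/esym/negbTE.
have lastE : last (v0 T) (rcons z c) = c by rewrite last_rcons.
have [NE q1 B1] := chain_mul C; rewrite -/p in NE q1 B1.
have [ep eN _ eh _] := chain_extend C.
exists c'; split; rewrite ?lastE //.
- move=> x xN; rewrite mem_rcons in_cons; have [->|xc] /= := eqVneq x c; first by left.
  have [xz|xz] := boolP (x \in z); [by left|right].
  by have [y] := chain_child C xN xz xc; rewrite -/p cE in_set1 => /eqP->.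
- move=> x; rewrite mem_rcons in_cons => /orP[/eqP->|xz].
    by have := gam_uniq c' (v0 T); rewrite (child_gam cc') => /andP[].
  by apply: contra (chain_above C xz); apply: descend.
- by move=> x; rewrite mem_rcons in_cons => /orP[/eqP->//|/(chain_dicr C)].
- move=> x; rewrite mem_rcons in_cons => /orP[/eqP->|]; last exact: (chain_pos C).
  by move=> cr; apply: (inner_DeltaZ HT HM Hgcd) => //; rewrite e2.
have [X [sE XP]] := chain_sum C; rewrite -/p in sE XP.
have B1' := branch_ge1 HT cc' (V_arrows0 (NV c'N)).
have DE : DeltaZ c = Nmul c - Nquot c by rewrite /DeltaZ e2 D0 big_set0 subrr mul0r add0r addr0.
have NquotE' : Nquot c = near c p * branch c c'.
  apply: (@mulIf _ (amul c)); first by apply/eqP; lia.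
  by rewrite -(NquotE HT HM cN) NE BE; ring.
exists (X + (near c p - 1) * (amul c - 1) * branch c c').
rewrite big_rcons /= addrC sE DE NquotE' NE BE; rewrite BE in XP.
clear - XP q1 a2 B1'; move: (near c p) (amul c) (branch c c') q1 a2 B1' XP => q m B q1 a2 B1 XP.
split; first by ring.
case: XP => [->|XP].
  have [->|q2] : q = 1 \/ 2 <= q by lia.
    by left; rewrite subrr !mul0r addr0.
  right; have : 1 <= (q - 1) * (m - 1) by nia.
  by rewrite add0r => h; nia.
right; have : 0 <= (q - 1) * (m - 1) by apply: mulr_ge0; lia.
move=> h; have : 0 <= (q - 1) * (m - 1) * B by apply: mulr_ge0; lia.
have : B <= m * B by nia.
lia.
Qed.

Lemma chain_end : exists z c, chain z c /\ (eps c = 2%N -> dicr_at c != set0).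
Proof.
have [c0 C0] := chain0.
suff main n z c : chain z c -> (#|cell T| - size z < n)%N ->
    exists z c, chain z c /\ (eps c = 2%N -> dicr_at c != set0).
  exact: main C0 (ltnSn _).
elim: n z c => [//|n IH] z c C lt_n.
have [/andP[/eqP e2 /eqP D0]|st] := boolP ((eps c == 2%N) && (dicr_at c == set0)).
  have [c' C'] := chain_step C e2 D0; apply: (IH _ _ C').
  have [_ uz] := chain_nonnil C'.
  have : (size (rcons z c) <= #|cell T|)%N by rewrite -(card_uniqP uz) max_card.
  rewrite size_rcons; lia.
exists z, c; split=> // e2; apply: contraNneq st => ->.
by rewrite e2 !eqxx.
Qed.

(** The total of Delta is 0, so the vertices outside [z] add up to M - 1 - X. *)
Lemma chain_rest z c : chain z c -> exists X,
  [/\ 0 <= X, X = 0 \/ branch (last (v0 T) z) c <= X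
    & DeltaZ c + \sum_(x in Ncal T | (x \notin z) && (x != c)) DeltaZ x
      = branch (last (v0 T) z) c - 1 - X].
Proof.
move=> C; have [X [sE XP]] := chain_sum C; have [v0z uz] := chain_nonnil C.
have [_ _ B1] := chain_mul C.
exists X; split=> //; first by clear -XP B1; case: XP; lia.
move: HD; rewrite (bigID [in z]) /= => E.
rewrite big_uniq // in sE.
have zE : \sum_(i in Ncal T | i \in z) DeltaZ i = \sum_(x in z) DeltaZ x.
  apply: eq_bigl => x; rewrite andbC; case xz: (x \in z) => //=.
  exact: (chain_N C).
rewrite zE sE (bigD1 c) /= ?(chain_cN C) ?(chain_c C) // in E.
rewrite (eq_bigl (fun x => (x \in Ncal T) && (x \notin z) && (x != c))) => [|x]; last first.
  by rewrite andbA.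
by clear -E; move: (\sum_(i | _) _) (branch _ _) (DeltaZ c) E => s B d; lia.
Qed.

Lemma rest_ge0 z c x : chain z c -> x \in Ncal T -> x \notin z -> 0 <= DeltaZ x.
Proof.
move=> C xN xz; apply: (nonroot_DeltaZ HT HM Hgcd) => //.
by apply: contraNneq xz => ->; have [] := chain_nonnil C.
Qed.

Lemma rest_sum_ge0 z c : chain z c ->
  0 <= \sum_(x in Ncal T | (x \notin z) && (x != c)) DeltaZ x.
Proof. by move=> C; apply: sumr_ge0 => x /and3P[xN xz _]; exact: rest_ge0 C xN xz. Qed.

Lemma rest_light z c : chain z c ->
  \sum_(x in Ncal T | (x \notin z) && (x != c)) DeltaZ x <= 0 ->
  forall x, x \in Ncal T -> x \notin z -> x != c -> x \in light_leaves T.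
Proof.
move=> C s0 x xN xz xc; apply: (nonroot_DeltaZ0 HT HM Hgcd) => //.
  by apply: contraNneq xz => ->; have [] := chain_nonnil C.
apply: le_trans s0; rewrite (bigD1 x) /= ?xN ?xz // lerDl.
by apply: sumr_ge0 => y /andP[/and3P[yN yz _] _]; exact: rest_ge0 C yN yz.
Qed.

Lemma all1_type v : (forall t, t \in dicr_at v -> degree t = 1%N) ->
  node_type v = nseq #|dicr_at v| 1%N.
Proof.
move=> d1; have sz : size (node_type v) = #|dicr_at v|.
  by rewrite /node_type size_sort size_map -cardE.
rewrite -sz; apply/all_pred1P/allP => d; rewrite mem_sort => /mapP[t].
by rewrite mem_enum => /d1-> ->; rewrite /= eqxx.
Qed.

(** A further entry N_v, together with the entry 1, would make the branch through
    [v] larger than N_v by [branch_lb]. *)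
Lemma one_full_only p v u : v \in Ncal T -> child p v -> branch p v <= Nmul v ->
  one_full v u -> dicr_at v = [set u] /\ node_type v = [:: 1%N].
Proof.
move=> vN pv BN vu; have [uv u1 full] := vu.
have DE : dicr_at v = [set u].
  apply/setP => t; rewrite in_set1; apply/idP/eqP => [tv|->//].
  apply/eqP/negPn/negP => tu; have := branch_lb HT HM vN pv.
  rewrite (bigD1 u) //= (bigD1 t) /=; last by rewrite tv.
  rewrite u1 full //; have := amul_ge1 HT HM vN.
  set s := (X in _ + (_ + X)); have : 0 <= s by apply: sumr_ge0.
  have := Npos vN; move: BN; clear.
  move: s (branch p v) (amul v) (Nmul v) (#|_|) => s B m n k; nia.
split=> //; rewrite all1_type ?DE ?cards1 // => t.
by rewrite in_set1 => /eqP->.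
Qed.

Let conclusion z :=
  let z1 := head (v0 T) z in
  let zn := last (v0 T) z in
  [/\ [/\ is_path z, {subset z <= Ncal T} & (1 < size z)%N],
      Omega T = [set z1] /\ z1 = v0 T,
      valency (v0 T) = 1%N,
      skeleton T = [set x in z]
    & [\/
          [/\ Ncal T = [set x in z],
              nodes T = [set zn]
            & node_type zn = [:: 1%N] \/ node_type zn = [:: 1%N; 1%N]],

          exists y1,
            [/\ [/\ y1 \notin z, Ncal T = y1 |: [set x in z]
                  & Nneighbors y1 = [set zn]],
                Vset zn = [set y1],
                nodes T = [set y1] \/ nodes T = [set zn; y1],
                type_1N y1
              & zn \in nodes T -> node_type zn = [:: 1%N]]
        |
          exists y1 y2,
            [/\ [/\ y1 \notin z, y2 \notin z & y1 != y2],
                Ncal T = [set y1; y2] :|: [set x in z],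
                Nneighbors y1 = [set zn] /\ Nneighbors y2 = [set zn],
                Vset zn = [set y1; y2] /\ nodes T = [set y1; y2]
              & type_1N y1 /\ type_1N y2]]].

Lemma nodes_light v : v \in light_leaves T -> v \in nodes T.
Proof.
case/light_leavesP=> vN vr ev _; rewrite nodesE vN.
exact: (leaf_dicr HT HM vN vr ev).
Qed.

Lemma chain_skeleton z c : chain z c -> 0 < DeltaZ c ->
  (forall x, x \in Ncal T -> x \notin z -> x != c -> x \in light_leaves T) ->
  skeleton T = [set x in rcons z c].
Proof.
move=> C dc L; rewrite (skeletonE HT HM Hgcd light_parent_pos); apply/setP => x.
rewrite in_setD [RHS]inE mem_rcons in_cons; apply/andP/orP => [[xL xN]|xz].
  have [->|xc] := eqVneq x c; first by left.
  by right; apply: contraNT xL => xz; exact: L.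
split; last by case: xz => [/eqP->|/(chain_N C)//]; exact: (chain_cN C).
apply/negP => /light_leavesP[xN xr _ dx].
case: xz => [/eqP xc|xz]; first by move: dc; rewrite -xc; lia.
by have := chain_pos C xz xr; lia.
Qed.

(** Nothing lies beyond [c], so Delta(c) = M - 1 - X with N_c = q M.  If the type is
    [1, N_c, ..., N_c] it is [1], by [one_full_only].  Otherwise the degrees, whose
    sum is at most M, must be two in number with a_c = q = 1, X = 0 and sum 2. *)
Lemma leaf_end z c : chain z c -> eps c = 1%N -> conclusion (rcons z c).
Proof.
move=> C ec; have cN := chain_cN C; have cr := chain_cr C; have pc := chain_last C.
have [zp zN zs zh zl] := chain_extend C.
have D0 := leaf_dicr HT HM cN cr ec.
have NE x : x \in Ncal T -> x \notin z -> x = c.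
  move=> xN xz; have [|cx] := chain_cover C xN; first by rewrite (negbTE xz).
  exact: leaf_desc cx.
have [NqM q1 B1] := chain_mul C.
have [X [X0 XP sE]] := chain_rest C.
rewrite [X in _ + X]big1 ?addr0 in sE; last first.
  by move=> x /and3P[xN xz]; rewrite (NE _ xN xz) eqxx.
have BN : branch (last (v0 T) z) c <= Nmul c by rewrite NqM; clear -q1 B1; nia.
have cof1 := Nquot_bounds HT HM cN.
have key : 0 < DeltaZ c /\ (node_type c = [:: 1%N] \/ node_type c = [:: 1%N; 1%N]).
  have [[u cu]|[u [t [uc tc ut du dt]]]] := type_cases HT HM Hgcd cN D0.
    have [DE ty] := one_full_only cN pc BN cu; split; last by left.
    have a1 : amul c <> 1.
      move=> a1; have := valency_ge3 HT HM cN cr.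
      by rewrite ec DE cards1 a1.
    have [/a1//|c2] := Nquot_half HT HM cN.
    rewrite /DeltaZ ec (defect_one_full cu); clear -c2 cof1; lia.
  have lb := branch_lb HT HM cN pc.
  have DeltaZE : DeltaZ c = 1 - Nquot c + #|dicr_at c|%:Z * Nmul c - \sum_(r in dicr_at c) (degree r)%:Z.
    rewrite /DeltaZ ec big_split /= sumr_const sumrN -mulr_natl natz; ring.
  have S2 : #|dicr_at c|%:Z <= \sum_(r in dicr_at c) (degree r)%:Z.
    rewrite card_sum1; apply: ler_sum => r /(degree_half HT HM cN)[].
    by clear; lia.
  have k2 : (1 < #|dicr_at c|)%N by apply/card_gt1P; exists u, t.
  have n2 := le_trans (_ : 2 <= 2 * (degree u)%:Z) du.
  have [u1 _ _] := degree_half HT HM cN uc.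
  have {}n2 : 2 <= Nmul c by apply: n2; clear -u1; lia.
  have aP := Nquot_half HT HM cN; have a1 := amul_ge1 HT HM cN.
  have cE := NquotE HT HM cN.
  have [k2' S2' M2] : [/\ #|dicr_at c| = 2%N,
      \sum_(r in dicr_at c) (degree r)%:Z = 2 & 0 < DeltaZ c].
    have [q1'|q2] : near c (last (v0 T) z) = 1 \/ 2 <= near c (last (v0 T) z).
      by clear -q1; lia.
      (* N_c = M: three degrees give Delta(c) > M, a dead end gives 2 sum d <= M *)
      rewrite q1' mul1r in NqM; clear -sE XP X0 NqM cof1 lb DeltaZE S2 k2 n2 aP a1 cE.
      move: (branch _ _) (\sum_(r in _) _) (#|_|) (#|_ :\ _|) (Nquot c) (amul c) (DeltaZ c) (Nmul c) sE XP NqM cof1 lb DeltaZE S2 k2 n2 aP a1 cE.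
      move=> B S k j f m D n sE XP NqM [f1 fn] lb DeltaZE S2 k2 n2 aP a1 cE.
      have mS : S <= m * S by nia.
      have k3 : k = 2%N.
        have [//|k3] : k = 2%N \/ (3 <= k)%N by lia.
        have : 3 * n <= k%:Z * n by nia.
        lia.
      rewrite k3 in DeltaZE S2 *.
      have [m1|m2] := aP; last first.
        have [m1|m2'] : m = 1 \/ 2 <= m by lia.
          by rewrite m1 mulr1 in cE; lia.
        have : 2 * S <= m * S by nia.
        by case: XP => XP; lia.
      rewrite m1 mulr1 in cE; rewrite m1 mul1r in lb.
      by case: XP => XP; split=> //; lia.
    (* N_c >= 2 M is incompatible with Delta(c) <= M - 1 *)
    exfalso; clear -sE XP X0 NqM cof1 lb DeltaZE S2 k2 n2 aP a1 cE q2 B1.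
    move: (near _ _) (branch _ _) (\sum_(r in _) _) (#|_|) (#|_ :\ _|) (Nquot c) (amul c) (DeltaZ c) (Nmul c) sE XP NqM cof1 lb DeltaZE S2 k2 n2 aP a1 cE q2 B1.
    move=> q B S k j f m D n sE XP NqM [f1 fn] lb DeltaZE S2 k2 n2 aP a1 cE q2 B1.
    have mS : S <= m * S by nia.
    have n2B : 2 * B <= n by nia.
    have : 2 * n <= k%:Z * n by nia.
    by lia.
  split=> //; right; rewrite all1_type ?k2' // => r rc.
  have : \sum_(r in dicr_at c) ((degree r)%:Z - 1) = 0.
    rewrite big_split /= S2' sumr_const k2'; by clear; lia.
  move/eqP; rewrite psumr_eq0 => [/allP/(_ r)|s sc].
    by rewrite mem_index_enum rc => /(_ isT) /= /eqP; clear; lia.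
  by have [] := degree_half HT HM cN sc; clear; lia.
have [dc ty] := key.
have NE' : Ncal T = [set x in rcons z c].
  apply/setP => x; rewrite [RHS]inE mem_rcons in_cons; apply/idP/orP => [xN|[/eqP->//|/(chain_N C)//]].
  by have [xz|/(NE _ xN)->] := boolP (x \in z); [right|left].
rewrite /conclusion zh zl; split=> //.
- by split=> //; exact: Omega_one.
- apply: (chain_skeleton C dc) => x xN xz; by rewrite (NE _ xN xz) eqxx.
constructor 1; split=> //; apply/setP => x; rewrite nodesE in_set1.
apply/andP/eqP => [[xN xD]|->]; last by rewrite cN D0.
by apply: (NE _ xN); apply: contra xD => /(chain_dicr C)->.
Qed.

Section InnerEnd.
Variables (z : seq (cell T)) (c : cell T).
Hypothesis C : chain z c.
Hypothesis e2 : (1 < eps c)%N.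
Hypothesis L : forall x, x \in Ncal T -> x \notin z -> x != c -> x \in light_leaves T.

Lemma inner_pos : 0 < DeltaZ c.
Proof. exact: (inner_DeltaZ HT HM Hgcd (chain_cN C) (chain_cr C) e2). Qed.

Lemma light_notin x : x \in light_leaves T -> x \notin rcons z c.
Proof.
have := chain_skeleton C inner_pos L; rewrite (skeletonE HT HM Hgcd light_parent_pos).
by move/setP/(_ x); rewrite in_setD [RHS]inE => <- ->.
Qed.

(** Inside the chain only [c] can have a light leaf as a child, and light leaves
    have no children in N. *)
Lemma light_child x : x \in light_leaves T -> child c x.
Proof.
move=> xL; have [xN xr _ _] := light_leavesP _ xL.
have := light_notin xL; rewrite mem_rcons in_cons negb_or => /andP[xc xz].
have pv := child_parent xr; have [|cx] := chain_cover C xN; first by rewrite (negbTE xz).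
move: cx; rewrite (child_gam pv) in_cons eq_sym (negbTE xc) /= => cp.
have pN := parent_N HT HM pv (NV xN).
have pz : parent x \notin z by apply/negP => /(chain_above C); rewrite cp.
have [<-//|pc] := eqVneq (parent x) c.
by have [_ _ _] := light_leavesP _ (L pN pz pc); have := light_parent_pos xL; lia.
Qed.

Lemma light_nbrs : light_leaves T = Nneighbors c :\ last (v0 T) z.
Proof.
have pc := chain_last C; apply/setP => x; rewrite in_setD1; apply/idP/andP => [xL|[xp xc]].
  have cx := light_child xL; have [xN _ _ _] := light_leavesP _ xL.
  split; last by rewrite in_set xN child_adj.
  by apply: contraTneq cx => ->; rewrite childE ?pc // (child_adjC pc).
have [xN cx] := NneighborsP xc; have {}cx := child_of_adj pc cx xp.
apply: L => //; last by rewrite eq_sym child_neq.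
by apply/negP => /(chain_above C); rewrite (child_gam cx) in_cons mem_gam_l orbT.
Qed.

Lemma card_light : (#|light_leaves T|).+1 = eps c.
Proof.
rewrite light_nbrs /eps -/(Nneighbors c) [RHS](cardsD1 (last (v0 T) z)).
by rewrite in_set (child_adjC (chain_last C)) (chain_N C (chain_pz C)).
Qed.

Lemma Ncal_light : Ncal T = light_leaves T :|: [set x in rcons z c].
Proof.
apply/setP => x; rewrite in_setU [x \in [set _ in _]]inE mem_rcons in_cons.
apply/idP/idP => [xN|/or3P[/light_leavesP[]//|/eqP->|/(chain_N C)//]].
  have [->|xc] := eqVneq x c; first by rewrite orbT.
  by have [xz|xz] := boolP (x \in z); rewrite ?orbT // L.
exact: (chain_cN C).
Qed.

Lemma Vset_light : Vset c = light_leaves T.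
Proof.
apply/setP => x; apply/(VsetP HT HM Hgcd)/idP => [[]//|xL].
by split=> //; [exact: light_child|exact: inner_pos].
Qed.

Lemma nodes_inner x : (x \in nodes T) = (x \in light_leaves T) || (x == c) && (dicr_at c != set0).
Proof.
apply/idP/idP => [|/orP[/nodes_light//|/andP[/eqP-> D0]]]; last by rewrite nodesE (chain_cN C).
rewrite nodesE => /andP[xN D0]; have [xc|xc] := eqVneq x c; first by rewrite -xc D0 orbT.
rewrite L //; apply: contra D0 => /(chain_dicr C) ->; exact: eqxx.
Qed.

Lemma light_type y : y \in light_leaves T -> Nneighbors y = [set c] /\ type_1N y.
Proof.
move=> yL; have [yN _ ey _] := light_leavesP _ yL; have cy := light_child yL.
split; last first.
  by have [_ _ [u]] := light_leaf_one_full HT HM Hgcd yL; exact: one_full_type.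
have /cards1P[x xE] : #|Nneighbors y| == 1%N by apply/eqP.
have : c \in Nneighbors y by rewrite in_set (chain_cN C) (child_adjC cy).
by rewrite xE in_set1 => /eqP->.
Qed.

End InnerEnd.

(** Here N_c >= 2, and Delta(c) together with the rest is at most M - 1 <= N_c - 1.
    If eps(c) = 2, the node [c] already contributes N_c - 1.  If eps(c) >= 3, the
    first term of Delta(c) does, which forces eps(c) = 3 and leaves no room for
    dicritical neighbours.  In both cases Delta vanishes on all vertices beyond
    [c], which are therefore light leaves adjacent to [c]. *)
Lemma inner_end z c : chain z c -> (1 < eps c)%N -> (eps c = 2%N -> dicr_at c != set0) ->
  conclusion (rcons z c).
Proof.
move=> C ec D2; have cN := chain_cN C; have cr := chain_cr C; have pc := chain_last C.
have [zp zN zs zh zl] := chain_extend C.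
have [NqM q1 B1] := chain_mul C.
have [X [X0 _ sE]] := chain_rest C; have r0 := rest_sum_ge0 C.
have BN : branch (last (v0 T) z) c <= Nmul c by rewrite NqM; clear -q1 B1; nia.
have [_ cofN] := Nquot_bounds HT HM cN; have dge := defect_ge0 HT HM cN.
have [y yN cy] := eps_child cN ec; have n2 := Nmul_ge2 HT HM yN cy.
have key : \sum_(x in Ncal T | (x \notin z) && (x != c)) DeltaZ x <= 0 /\
    ((eps c = 2%N /\ exists u, one_full c u) \/ (eps c = 3%N /\ dicr_at c = set0)).
  have [e2|e3] : eps c = 2%N \/ (3 <= eps c)%N by clear -ec; lia.
    have := sE; rewrite /DeltaZ e2 subrr mul0r add0r.
    have [[u cu]|dN] := defect_node HT HM Hgcd cN (D2 e2).
      rewrite (defect_one_full cu) => E; split; last by left; split=> //; exists u.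
      by clear -E r0 cofN X0 BN; move: (\sum_(x | _) _) r0 E => s; lia.
    move=> E; exfalso; clear -E r0 cofN X0 BN dN.
    move: (\sum_(x in dicr_at _) _) (\sum_(x | _) _) r0 E dN => d s; lia.
  have [D0|D0] := eqVneq (dicr_at c) set0.
    have := sE; rewrite /DeltaZ D0 big_set0 addr0 => E.
    clear -E r0 cofN X0 BN n2 e3.
    move: (\sum_(x | _) _) r0 E => s r0 E.
    have h : ((eps c)%:Z - 3) * (Nmul c - 1) <= 0 by lia.
    have e3' : eps c = 3%N by nia.
    by rewrite e3' in E; split; [lia|right].
  exfalso; have dN : Nmul c - 1 <= \sum_(t in dicr_at c) (Nmul c - (degree t)%:Z).
    have [[u cu]|dN] := defect_node HT HM Hgcd cN D0; first by rewrite (defect_one_full cu).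
    by apply: le_trans dN; rewrite gerBl.
  have := sE; rewrite /DeltaZ => E; clear -E r0 cofN X0 BN n2 e3 dN.
  move: (\sum_(x in dicr_at _) _) (\sum_(x | _) _) r0 E dN => d s r0 E dN.
  have h : 0 <= ((eps c)%:Z - 3) * (Nmul c - 1) by apply: mulr_ge0; lia.
  by lia.
have [s0 typ] := key; have L := rest_light C s0.
have cL := card_light C ec L; have NE := Ncal_light C L; have VE := Vset_light C ec L.
have nE := nodes_inner C L.
rewrite /conclusion zh zl; split=> //.
- by split=> //; exact: Omega_one.
- exact: (chain_skeleton C (inner_pos C ec) L).
case: typ => [[e2 [u cu]]|[e3 D0]].
  have /cards1P[y1 lE] : #|light_leaves T| == 1%N by rewrite -eqSS cL e2.
  have y1L : y1 \in light_leaves T by rewrite lE set11.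
  have [nb ty] := light_type C ec L y1L.
  constructor 2; exists y1; split=> //.
  - by split=> //; [exact: (light_notin C ec L)|rewrite NE lE].
  - by rewrite VE lE.
  - right; apply/setP => x; rewrite nE lE in_set1 in_set2 D2 // andbT; exact: orbC.
  by move=> _; have [] := one_full_only cN pc BN cu.
have /cards2P[y1 [y2 [y12 lE]]] : #|light_leaves T| == 2%N by rewrite -eqSS cL e3.
have y1L : y1 \in light_leaves T by rewrite lE set21.
have y2L : y2 \in light_leaves T by rewrite lE set22.
have [nb1 ty1] := light_type C ec L y1L; have [nb2 ty2] := light_type C ec L y2L.
constructor 3; exists y1, y2; split=> //.
- by split=> //; exact: (light_notin C ec L).
- by rewrite NE lE.
split; first by rewrite VE lE.
by apply/setP => x; rewrite nE lE D0 eqxx andbF orbF.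
Qed.

Lemma one_leaf_case : exists z, conclusion z.
Proof.
have [z [c [C D2]]] := chain_end; exists (rcons z c).
have := eps_ge1 HT HM (chain_cN C) (chain_cr C); rewrite leq_eqVlt => /orP[/eqP ec|ec].
  exact: leaf_end.
exact: inner_end.
Qed.

End OneLeaf.

Theorem proposition8p9 (T : drtree) (rationalT : rational_tree T)
    (nodesT : nodes T = nodes_star T) :
  [/\
      Omega T = set0 -> elementary1 T \/ elementary2 T,

      #|Omega T| = 1%N ->
      exists z : seq (cell T),
        let z1 := head (v0 T) z in
        let zn := last (v0 T) z in
        [/\ [/\ is_path z, {subset z <= Ncal T} & (1 < size z)%N],
            Omega T = [set z1] /\ z1 = v0 T,
            valency (v0 T) = 1%N,
            skeleton T = [set x in z]
          & [\/
                [/\ Ncal T = [set x in z],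
                    nodes T = [set zn]
                  & node_type zn = [:: 1%N] \/ node_type zn = [:: 1%N; 1%N]],

                exists y1,
                  [/\ [/\ y1 \notin z, Ncal T = y1 |: [set x in z]
                        & Nneighbors y1 = [set zn]],
                      Vset zn = [set y1],
                      nodes T = [set y1] \/ nodes T = [set zn; y1],
                      type_1N y1
                    & zn \in nodes T -> node_type zn = [:: 1%N]]
              |
                exists y1 y2,
                  [/\ [/\ y1 \notin z, y2 \notin z & y1 != y2],
                      Ncal T = [set y1; y2] :|: [set x in z],
                      Nneighbors y1 = [set zn] /\ Nneighbors y2 = [set zn],
                      Vset zn = [set y1; y2] /\ nodes T = [set y1; y2]
                    & type_1N y1 /\ type_1N y2]]]
    &
      #|Omega T| = 2%N ->
      exists z : seq (cell T),
        [/\ trivial_path z /\ Ncal T = [set x in z],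
            size z = 2%N \/ size z = 3%N,
            size z = 3%N -> v0 T = nth (v0 T) z 1,
            forall x, x \in z -> amul x = 1
          & nodes T = [set head (v0 T) z; last (v0 T) z] /\
            forall v, v \in nodes T ->
              type_1N v /\ (size (node_type v) = 1%N <-> v = v0 T)]].
Proof.
have [HT HM HD _] := rationalT.
have HDz : \sum_(v in Ncal T) DeltaZ v = 0.
  apply/eqP; rewrite -(intr_eq0 rat) rmorph_sum /=; apply/eqP.
  by rewrite -[RHS]HD; apply: eq_bigr => v vN; rewrite (DeltaE HT HM).
have [e0|e1] := posnP (eps (v0 T)).
  rewrite (Omega_root HT HM e0) cards0; split=> // _.
  exact: (elementary_case HT HM nodesT HDz e0).
have [val1|val1] := eqVneq (valency (v0 T)) 1%N.
  have OE := Omega_one HT HM nodesT HDz e1 val1.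
  have cO : #|Omega T| = 1%N by rewrite OE cards1.
  split=> [O0|_|]; rewrite ?cO //.
  - by rewrite O0 cards0 in cO.
  exact: (one_leaf_case HT HM nodesT HDz e1 val1).
have [cO concl] := two_leaves_case HT HM nodesT HDz e1 (elimN eqP val1).
split=> [O0||//]; rewrite ?cO //.
by rewrite O0 cards0 in cO.
Qed.
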